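(* Let $\ell\ge 1$ and $b,u\ge 0$ be integers. The pebble tree fan $\mathcal{PF}_\ell^{b,u}$, i.e. the collection of cones $\mathbb{C}(T)$ for all pebble trees $T\in\mathcal{P}_\ell^{b,u}$, is an essential complete simplicial fan in the linear space $\mathbb{H}_\ell^{b,u}$, whose face lattice (its cones ordered by inclusion) is isomorphic to the pebble tree contraction poset $\mathcal{PP}_\ell^{b,u}$.
   Context: **Pebble trees.** An ordered tree is either a leaf or a node with a nonempty ordered list of subtrees (its children). A subtree of $T$ is the full tree rooted at one of the nodes or leaves of $T$ (including $T$ itself). Leaves are numbered $1,\dots,\ell$ from left to right. For a finite set of colors $\Gamma$, a $\Gamma$-pebble tree is an ordered tree with finitely many pebbles colored by $\Gamma$ placed on its nodes (pebbles of the same color are indistinguishable, and several may lie on the same node) such that: (i) leaves receive no pebble, each node with a single child receives at least one pebble, and nodes with at least two children receive arbitrarily many pebbles (possibly none); (ii) for each subtree $S$ and each color $\gamma\in\Gamma$, the number $\Delta_\gamma(S)$ of leaves of $S$ minus the number of pebbles of color $\gamma$ in $S$ is $0$ or $1$. $S$ is $\gamma$-balanced if $\Delta_\gamma(S)=0$ and $\gamma$-unbalanced if $\Delta_\gamma(S)=1$. $\mathsf{L}(S)$ denotes the set of leaves of $S$ (an interval of $[\ell]$) and $\mathsf{B}(S)$ the set of colors for which $S$ is balanced. $\mathcal{P}_\ell^{b,u}$ is the set of pebble trees with $\ell$ leaves and colors $[b+u]=\{1,\dots,b+u\}$ which (as whole trees) are balanced for the colors in $[b]$ and unbalanced for the colors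 in $\{b+1,\dots,b+u\}$. **Contraction poset.** For a node $c$ of $T$ (not a leaf, nor the root) with parent $p$, the contraction $T/c$ is obtained by replacing $c$ by its children in the list of children of $p$ and adding to $p$ the pebbles of $c$. $\mathcal{PP}_\ell^{b,u}$ is the set $\mathcal{P}_\ell^{b,u}$ ordered by $T'\le T$ if $T'$ is obtained from $T$ by a (possibly empty) sequence of contractions. **Vectors.** For an interval $L=[s,t]\subseteq[\ell]$ and $B\subseteq[b+u]$, let $L\otimes B=\bigcup_{p\in B}[\ell p+s-1,\ell p+t-1]$ and $L\boxtimes B=[s,t-1]\cup(L\otimes B)$ (integer intervals). For a subtree $S$, let $\lambda(S)=\mathsf{L}(S)\boxtimes\mathsf{B}(S)$. Let $I_0=[1,\ell(b+1)-1]$, $I_i=[\ell(b+i),\ell(b+i+1)-1]$ for $i\in[u]$, and $I=I_0\sqcup I_1\sqcup\dots\sqcup I_u=[1,\ell(b+u+1)-1]$. For $J\subseteq I$ let $\mathbf{1}_J=\sum_{j\in J}\mathbf{e}_j\in\mathbb{R}^I$. Let $\mathbb{H}_\ell^{b,u}=\{\mathbf{x}\in\mathbb{R}^I : \langle\mathbf{1}_{I_i},\mathbf{x}\rangle=0\text{ for all }0\le i\le u\}$, and for $J\subseteq I$ let $\mathbf{r}_J=\sum_{i=0}^u\big(|I_i\setminus J|\,\mathbf{1}_{I_i\cap J}-|I_i\cap J|\,\mathbf{1}_{I_i\setminus J}\big)\in\mathbb{H}_\ell^{b,u}$. For a subtree $S$ put $\mathbf{r}_S=\mathbf{r}_{\lambda(S)}$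 (this is $\mathbf{0}$ when $S$ is a leaf or the whole tree). **Fan.** $\mathbb{C}(T)$ is the cone (nonnegative span) generated by the vectors $\mathbf{r}_S$ for all subtrees $S$ of $T$. A fan is a set of polyhedral cones closed under taking faces and such that any two cones intersect along a face of both; it is essential if the intersection of its cones is the origin, complete if its cones cover the ambient space, simplicial if each cone is generated by linearly independent vectors. *)

(* Defs.v *)
From mathcomp Require Import all_boot all_order all_algebra.
From mathcomp Require Import all_classical reals.
From Stdlib Require Relation_Operators.

Set Implicit Arguments.
Unset Strict Implicit.
Unset Printing Implicit Defensive.

Import Order.TTheory GRing.Theory Num.Theory.

Local Open Scope classical_set_scope.
Local Open Scope ring_scope.

(* [Node p ch] carries [p g] pebbles of color [g].  That nodes have at least
   one child is part of [pebble_tree] below. *)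
Inductive ptree (G : finType) : Type :=
| Leaf
| Node (p : {ffun G -> nat}) (ch : seq (ptree G)).

Arguments Leaf {G}.

Section PebbleTrees.
Variable G : finType.
Implicit Types (T S : ptree G) (g : G).

Fixpoint leaves T : nat :=
  if T is Node _ ch then sumn (map leaves ch) else 1%N.

Fixpoint pebbles g T : nat :=
  if T is Node p ch then (p g + sumn (map (pebbles g) ch))%N else 0%N.

Definition Delta g T : int := (leaves T)%:Z - (pebbles g T)%:Z.

(* All subtrees [S] of [T] (one entry per node or leaf), each paired with the
   number of its leftmost leaf when the leaves of [T] are numbered from [s]. *)
Fixpoint subtrees (s : nat) T : seq (nat * ptree G) :=
  (s, T) ::
  if T is Node _ ch then
    (fix forest (s : nat) (ch : seq (ptree G)) : seq (nat * ptree G) :=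
       if ch is T1 :: ch1 then subtrees s T1 ++ forest (s + leaves T1)%N ch1
       else [::]) s ch
  else [::].

Definition node_ok T : bool :=
  if T is Node p ch then
    (0 < size ch)%N && ((size ch == 1%N) ==> (0 < \sum_g p g)%N)
  else true.

Definition pebble_tree T : bool :=
  all (fun S => node_ok S && [forall g, (Delta g S == 0) || (Delta g S == 1)])
      [seq sS.2 | sS <- subtrees 1 T].

Definition balanced_colors T : {set G} := finset (fun g => Delta g T == 0).

(* [contraction T T'] : [T'] is [T/c] for some non-leaf, non-root node [c]. *)
Inductive contraction : ptree G -> ptree G -> Prop :=
| contraction_child p l q ch r :
    contraction (Node p (l ++ Node q ch :: r))
                (Node [ffun g => (p g + q g)%N] (l ++ ch ++ r))
| contraction_below p l S S' r :
    contraction S S' ->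
    contraction (Node p (l ++ S :: r)) (Node p (l ++ S' :: r)).

Definition contraction_le T' T : Prop :=
  Relation_Operators.clos_refl_trans _ contraction T T'.

End PebbleTrees.

(* The color [p : 'I_(b + u)] stands for the color [p.+1] among 1, ..., b + u. *)
Definition pebble_trees (l b u : nat) : set (ptree 'I_(b + u)) :=
  [set T | [/\ pebble_tree T, leaves T = l
             & forall p : 'I_(b + u), Delta p T = if (p < b)%N then 0 else 1]].
Arguments pebble_trees : clear implicits.

(* The ordinal [j : 'I_n] stands for the integer [j.+1] of [1, n]. *)
Definition itv (n a c : nat) : {set 'I_n} :=
  finset (fun j : 'I_n => (a <= j.+1 <= c)%N).

(* [otimes] and [boxtimes] take the interval L = [s, t] of leaves, with
   1 <= s <= t, through its end points, so the truncated subtractions are exact.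
   The index set [1, n] they are read in is [1, l (b + u + 1) - 1] below. *)
Definition otimes (l n k s t : nat) (B : {set 'I_k}) : {set 'I_n} :=
  \bigcup_(p in B) itv n (l * p.+1 + s - 1)%N (l * p.+1 + t - 1)%N.

Definition boxtimes (l n k s t : nat) (B : {set 'I_k}) : {set 'I_n} :=
  (itv n s (t - 1) :|: otimes l n s t B)%SET.

Definition ambient_dim (l b u : nat) : nat := (l * (b + u + 1) - 1)%N.

Definition lambda (l b u : nat) (sS : nat * ptree 'I_(b + u)) :
    {set 'I_(ambient_dim l b u)} :=
  let: (s, S1) := sS in
  boxtimes l (ambient_dim l b u) s (s + leaves S1 - 1)%N (balanced_colors S1).

Definition block (l b u i : nat) : {set 'I_(ambient_dim l b u)} :=
  if i == 0%N then itv _ 1 (l * (b + 1) - 1)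
  else itv _ (l * (b + i)) (l * (b + i + 1) - 1).

Section Geometry.
Variables (R : realType) (n : nat).
Local Notation V := 'rV[R]_n.

Definition dot (x y : V) : R := \sum_j x 0 j * y 0 j.

Definition indicator (J : {set 'I_n}) : V := \sum_(j in J) delta_mx 0 j.

Definition cone (s : seq V) : set V :=
  [set x | exists c : 'I_(size s) -> R,
     (forall i, 0 <= c i) /\ x = \sum_i c i *: s`_i].

Definition polyhedral_cone (C : set V) : Prop := exists s : seq V, C = cone s.

(* Faces are the intersections with supporting hyperplanes; [a = 0] gives the
   cone itself, and the empty set is not a face. *)
Definition face_of (D C : set V) : Prop :=
  exists a : V, (forall x, C x -> 0 <= dot a x) /\
                D = C `&` [set x | dot a x = 0].

Definition fan (F : set (set V)) : Prop :=
  [/\ forall C, F C -> polyhedral_cone C,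
      forall C D, F C -> face_of D C -> F D
    & forall C D, F C -> F D ->
        face_of (C `&` D) C /\ face_of (C `&` D) D].

Definition essential (F : set (set V)) : Prop := \bigcap_(C in F) C = [set 0].

(* The equality also says that every cone of [F] lies in [H]. *)
Definition complete_in (H : set V) (F : set (set V)) : Prop :=
  \bigcup_(C in F) C = H.

Definition simplicial (F : set (set V)) : Prop :=
  forall C, F C -> exists s : seq V, free s /\ C = cone s.

End Geometry.

Definition poset_isomorphic (X Y : Type) (A : set X) (leA : X -> X -> Prop)
    (B : set Y) (leB : Y -> Y -> Prop) : Prop :=
  exists f : X -> Y, set_bij A B f /\
    forall x y, A x -> A y -> (leA x y <-> leB (f x) (f y)).

Section PebbleTreeFan.
Variables (R : realType) (l b u : nat).
Local Notation V := 'rV[R]_(ambient_dim l b u).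

Definition Hspace : set V :=
  [set x | forall i : 'I_u.+1, dot (indicator R (block l b u i)) x = 0].

Definition rvec (J : {set 'I_(ambient_dim l b u)}) : V :=
  \sum_(i < u.+1)
    (let Ii := block l b u i in
     #|(Ii :\: J)%SET|%:R *: indicator R (Ii :&: J)%SET
     - #|(Ii :&: J)%SET|%:R *: indicator R (Ii :\: J)%SET).

Definition tree_cone (T : ptree 'I_(b + u)) : set V :=
  cone [seq rvec (lambda l sS) | sS <- subtrees 1 T].

Definition pebble_tree_fan : set (set V) :=
  [set tree_cone T | T in pebble_trees l b u].

End PebbleTreeFan.
Arguments Hspace : clear implicits.
Arguments pebble_tree_fan : clear implicits.

(* Main.v *)
Require Import Defs.
From mathcomp Require Import all_boot all_order all_algebra.
From mathcomp Require Import all_classical reals.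
From mathcomp Require Import zify ring lra.
From Stdlib Require Relation_Operators.

(* Modulo the span of the indicators of the blocks I_0, ..., I_u, and up to
   rescaling each block by its size, the ray of a subtree S is the indicator of
   its tube lambda(S), so one studies positive combinations y of indicators of
   tubes.  A nonnegative function y on gaps and colored leaves is such a
   combination for exactly one pebble forest: the components of the leaves cut
   at the zero gaps of y are the leaf sets of its trees, a tree is balanced for
   the colors for which y is positive on all its leaves, and the coefficient of
   its root is the minimum of y on the tube of the root; subtracting it and
   recursing gives the children.  The pebble conditions say exactly that this
   minimum is attained where no proper subtree contributes.  Hence every vector
   of H lies in the relative interior of the cone of exactly one tree.

   Contractions of T delete one tube at a time, and any set of tubes of proper
   subtrees of T can be deleted in this way, so the faces of C(T) are the cones
   of the contractions of T.  If x lies in C(T) and C(T'),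
     the tree with x in the
   relative interior of its cone is a contraction of both,
     so C(T) and C(T') meet
   in the cone of their common rays.  The order isomorphism follows by applying
   this to the sum of the rays of T. *)

Set Implicit Arguments.
Unset Strict Implicit.
Unset Printing Implicit Defensive.

Import Order.TTheory GRing.Theory Num.Theory.

Local Open Scope ring_scope.

(** * Pebble forests and their tubes *)

Section Forests.
Variable G : finType.
Implicit Types (T S : ptree G) (F ch : seq (ptree G)) (g : G) (o : option G).

(** The children of a node and the siblings to its right are both forests, so the inductions run
    over forests; the generated principle of [ptree] gives no hypothesis on the children. *)
Lemma forest_ind (P : seq (ptree G) -> Prop) :
  P [::] -> (forall F, P F -> P (Leaf :: F)) ->
  (forall p ch F, P ch -> P F -> P (Node p ch :: F)) ->
  forall F, P F.
Proof.
move=> P0 PL PN.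
have PT : forall T F, P F -> P (T :: F).
  fix IH 1 => -[|p ch] F PF; first exact: PL.
  apply: PN PF.
  by elim: ch => [//|T1 ch1 Pch1]; apply: IH.
by elim=> // T F; apply: PT.
Qed.

Definition is_node T := if T is Node _ _ then true else false.
Definition children T := if T is Node _ ch then ch else [::].

Definition fleaves F := sumn (map (@leaves G) F).
Definition unbalanced g F := count (fun T => Delta g T != 0) F.

(** A named copy of the fixpoint hidden in [subtrees], so that [subtreesE] holds by computation. *)
Fixpoint forest (s : nat) F : seq (nat * ptree G) :=
  if F is T :: F' then subtrees s T ++ forest (s + leaves T)%N F' else [::].

Lemma subtreesE s T :
  subtrees s T = (s, T) :: forest s (children T).
Proof.
by case: T.
Qed.

Lemma forest_cons s T F :
  forest s (T :: F) = subtrees s T ++ forest (s + leaves T)%N F.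
Proof. by []. Qed.

Lemma forest_cat s F1 F2 :
  forest s (F1 ++ F2) = forest s F1 ++ forest (s + fleaves F1)%N F2.
Proof.
elim: F1 s => [|T F1 IH] s /=; first by rewrite addn0.
by rewrite IH -catA /fleaves /= addnA.
Qed.

Lemma forest_subtrees_start s s' F :
  [seq e.2 | e <- forest s F] = [seq e.2 | e <- forest s' F].
Proof.
elim/forest_ind: F s s' => [//|F IH|p ch F IHch IHF] s s'.
  by rewrite /= (IH _ (s' + 1)%N).
rewrite !forest_cons !subtreesE /= !map_cat.
by rewrite (IHch _ s') (IHF _ (s' + sumn (map (@leaves G) ch))%N).
Qed.

Definition Delta01 T := [forall g, (Delta g T == 0) || (Delta g T == 1)].

Lemma pebble_treeE T :
  pebble_tree T =
  [&& node_ok T, Delta01 T & all (@pebble_tree G) (children T)].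
Proof.
rewrite {1}/pebble_tree subtreesE /= -andbA; congr [&& _, _ & _].
elim: (children T) 1%N => // {}T ch IH s.
rewrite forest_cons map_cat all_cat IH [RHS]/=; congr (_ && _).
by have := forest_subtrees_start s 1 [:: T];
  rewrite /forest !cats0 /pebble_tree => ->.
Qed.

Lemma pebble_tree_leaf : pebble_tree (@Leaf G).
Proof.
by rewrite pebble_treeE /= andbT; apply/forallP => g; rewrite /Delta /=.
Qed.

(** Each child has [Delta] 0 or 1, so these values add up to the number of unbalanced children. The
    pebble condition thereby becomes local to each node. *)
Lemma Delta_node g p ch : all (@pebble_tree G) ch ->
  Delta g (Node p ch) = (unbalanced g ch)%:Z - (p g)%:Z.
Proof.
rewrite /Delta /= => okch.
suff : sumn (map (@leaves G) ch) =
   (sumn (map (pebbles g) ch) + unbalanced g ch)%N by lia.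
elim: ch okch => //= T ch IH /andP[okT /IH ->].
move: okT; rewrite pebble_treeE => /and3P[_ /forallP /(_ g) D01 _].
suff -> : leaves T = (pebbles g T + (Delta g T != 0%R))%N.
  by rewrite /unbalanced /=; lia.
by move: D01; rewrite /Delta; lia.
Qed.

Lemma leaves_gt0 T : pebble_tree T -> (0 < leaves T)%N.
Proof.
suff H : forall F, all (@pebble_tree G) F -> (0 < size F)%N -> (0 < fleaves
  F)%N.
  by move=> okT; have := H [:: T]; rewrite /fleaves /= okT addn0; apply.
elim/forest_ind => //= p ch F IHch _ /andP[okN _] _.
move: okN; rewrite pebble_treeE /= => /and3P[/andP[sz _] _ okch].
by have := IHch okch sz; rewrite /fleaves /=; lia.
Qed.

Lemma size_fleaves F : all (@pebble_tree G) F -> (size F <= fleaves F)%N.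
Proof.
elim: F => //= T F IH /andP[/leaves_gt0 + /IH]; rewrite /fleaves /=; lia.
Qed.

Definition tube (e : nat * ptree G) : nat * nat * {set G} :=
  (e.1, leaves e.2, balanced_colors e.2).

(* [(None, j)] is the gap between the leaves [j] and [j.+1], and [(Some g, j)]
   is the copy of the leaf [j] in the block of coordinates of the color [g]. *)
Definition in_tube (k : nat * nat * {set G}) o (j : nat) : bool :=
  let: (s, m, B) := k in
  if o is Some g then (g \in B) && (s <= j < s + m)%N
  else (s <= j)%N && (j.+1 < s + m)%N.

(** Leaves are skipped: a leaf spans no gap and is balanced for no color, so its tube is empty. *)
Definition ftubes s F := [seq tube e | e <- forest s F & is_node e.2].

Lemma ftubes_leaf s F : ftubes s (Leaf :: F) = ftubes s.+1 F.
Proof. by rewrite /ftubes /= addn1. Qed.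

Lemma ftubes_node s p ch F :
  ftubes s (Node p ch :: F) =
  tube (s, Node p ch) :: ftubes s ch ++ ftubes (s + fleaves ch)%N F.
Proof.
rewrite /ftubes forest_cons subtreesE /=.
by rewrite filter_cat map_cat.
Qed.

Lemma ftubes_cat s F1 F2 :
  ftubes s (F1 ++ F2) = ftubes s F1 ++ ftubes (s + fleaves F1)%N F2.
Proof. by rewrite /ftubes forest_cat filter_cat map_cat. Qed.

Lemma fleaves_cat F1 F2 : fleaves (F1 ++ F2) = (fleaves F1 + fleaves F2)%N.
Proof. by rewrite /fleaves map_cat sumn_cat. Qed.

Lemma ftubes_cons s T F :
  ftubes s (T :: F) = ftubes s [:: T] ++ ftubes (s + leaves T)%N F.
Proof. by rewrite (ftubes_cat s [:: T] F) /fleaves /= addn0. Qed.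

Lemma ftubes_range s F k o j : k \in ftubes s F -> in_tube k o j ->
  in_tube (s, fleaves F, [set: G]%SET) o j.
Proof.
elim/forest_ind: F s => [|F IH|p ch F IHch IHF] s //.
  rewrite ftubes_leaf => /IH{}IH /IH; rewrite /fleaves /=.
  by case: o {IH} => [g|]; rewrite ?inE /=; lia.
rewrite ftubes_node inE mem_cat => /or3P[/eqP-> | /IHch{}IH /IH | /IHF{}IH /IH].
- by rewrite /fleaves /=; case: o {IHch IHF} => [g|]; rewrite ?inE /=; lia.
- by move: IH; rewrite /fleaves /=; case: o {IHch IHF} => [g|];
  rewrite ?inE /=; lia.
- by move: IH; rewrite /fleaves /=; case: o {IHch IHF} => [g|];
  rewrite ?inE /=; lia.
Qed.

Lemma gap_avoids_ftubes s T F k : pebble_tree T ->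
  k \in ftubes s (T :: F) -> ~~ in_tube k None (s + leaves T).-1.
Proof.
move=> /leaves_gt0 T0; rewrite ftubes_cons mem_cat => kF.
apply/negP => ink; case/orP: kF => /ftubes_range /(_ ink);
  by rewrite /= /fleaves /=; lia.
Qed.

(** A leaf is its own witness. The tube of an unbalanced node omits the color, and by [Delta_node]
    the node has an unbalanced child, in which the search continues. *)
Lemma unbalanced_avoids_ftubes s F g :
  all (@pebble_tree G) F -> (0 < unbalanced g F)%N ->
  exists2 j, (s <= j < s + fleaves F)%N &
    forall k, k \in ftubes s F -> ~~ in_tube k (Some g) j.
Proof.
elim/forest_ind: F s => [//|F IH|p ch F IHch IHF] s /= /andP[okN okF] ub.
  exists s; first by rewrite /fleaves /=; lia.
  move=> k; rewrite ftubes_leaf => kF; apply/negP => /(ftubes_range kF) /=.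
  lia.
have okch : all (@pebble_tree G) ch.
  by move: okN; rewrite pebble_treeE => /and3P[].
have [N0|N1] := eqVneq (Delta g (Node p ch)) 0.
  move: ub; rewrite /unbalanced /= N0 eqxx add0n => ub.
  have [j jF Hj] := IHF (s + fleaves ch)%N okF ub.
  exists j; first by move: jF; rewrite /fleaves /=; lia.
  move=> k; rewrite ftubes_node inE mem_cat.
  case/or3P => [/eqP->|kch|]; last exact: Hj.
    by rewrite /= -/(fleaves _); lia.
  by apply/negP => /(ftubes_range kch) /=; lia.
have ubch : (0 < unbalanced g ch)%N.
  move: okN; rewrite pebble_treeE => /and3P[_ /forallP /(_ g)].
  by move: N1; rewrite Delta_node //; lia.
have [j jF Hj] := IHch s okch ubch.
exists j; first by move: jF; rewrite /fleaves /=; lia.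
move=> k; rewrite ftubes_node inE mem_cat.
case/or3P => [/eqP->|kch|kF]; last 1 first.
- by apply/negP => /(ftubes_range kF) /=; lia.
- by rewrite /= inE (negbTE N1).
- exact: Hj.
Qed.

(** With at least two children, no child covers the gap between the first two. With one child, some
    color has a pebble on the node; for this color the node must be balanced and the child
    unbalanced, so a colored leaf stays uncovered. *)
Lemma node_avoids_ftubes s p ch : pebble_tree (Node p ch) ->
  exists o j, in_tube (tube (s, Node p ch)) o j /\
    forall k, k \in ftubes s ch -> ~~ in_tube k o j.
Proof.
move=> okN; have := okN; rewrite pebble_treeE => /and3P[ok1 D01 okch].
case: ch ok1 okN D01 okch => [//|T [|T2 ch]] /= ok1 okN D01 okch.
  have [g pg] : exists g, (0 < p g)%N.
    move: ok1; rewrite lt0n sum_nat_eq0 negb_forall => /existsP[g].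
    by rewrite implyTb -lt0n; exists g.
  have := forallP D01 g; rewrite Delta_node // => DN.
  have ub : (0 < unbalanced g [:: T])%N by lia.
  have [j jT Hj] := @unbalanced_avoids_ftubes s [:: T] g okch ub.
  exists (Some g), j; split => //.
  rewrite /= inE Delta_node // -/(fleaves [:: T]) jT andbT.
  by move: DN; rewrite /unbalanced /=; case: (Delta g T != 0); lia.
have /and3P[okT okT2 _] := okch.
exists None, (s + leaves T).-1; split.
  by move: (leaves_gt0 okT) (leaves_gt0 okT2); rewrite /=; lia.
by move=> k; apply: gap_avoids_ftubes.
Qed.

(** The tube of a node is nonempty and a single leaf has no gap. This tells such a node apart from a
    leaf. *)
Lemma node1_balanced p ch : pebble_tree (Node p ch) ->
  leaves (Node p ch) = 1%N -> exists g, g \in balanced_colors (Node p ch).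
Proof.
move=> okN L1; have [[g|] [j []]] := node_avoids_ftubes 0 okN.
  by case/andP => gB _ _; exists g.
by rewrite /in_tube /tube [(_, _).2]/= L1 /=; lia.
Qed.

End Forests.

(** * Positive combinations of tubes *)

Section PositiveCombinations.
Variables (R : realFieldType) (G : finType).
Implicit Types (T S : ptree G) (F ch : seq (ptree G)) (g : G) (o : option G).
Implicit Types (k : nat * nat * {set G}) (ks : seq (nat * nat * {set G})).
Implicit Types (y z : option G -> nat -> R).

(** Coefficients are strictly positive, as in a relative interior. Working with functions on gaps
    and colored leaves lets subforests start at any leaf without fixing coordinates. *)
Fixpoint poscomb ks y : Prop :=
  if ks is k :: ks' then
    exists c z, [/\ 0 < c, poscomb ks' z &
      forall o j, y o j = c * (in_tube k o j)%:R + z o j]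
  else forall o j, y o j = 0.

Lemma poscomb_ext ks y z :
  (forall o j, y o j = z o j) -> poscomb ks y -> poscomb ks z.
Proof.
case: ks => [|k ks] yz /=; first by move=> y0 o j; rewrite -yz.
by case=> c [x [c0 kx yE]]; exists c, x; split=> // o j; rewrite -yz.
Qed.

Lemma poscomb_cat ks1 ks2 y : poscomb (ks1 ++ ks2) y <->
  exists y1 y2, [/\ poscomb ks1 y1, poscomb ks2 y2 &
    forall o j, y o j = y1 o j + y2 o j].
Proof.
elim: ks1 y => [|k ks1 IH] y /=; split.
- by move=> ky; exists (fun _ _ => 0), y; split=> // o j; rewrite add0r.
- case=> y1 [y2 [y10 ky2 yE]]; apply: poscomb_ext ky2 => o j.
  by rewrite yE y10 add0r.
- case=> c [z [c0 /IH[z1 [z2 [k1 k2 zE]]] yE]].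
  exists (fun o j => c * (in_tube k o j)%:R + z1 o j), z2; split=> //.
    by exists c, z1.
  by move=> o j; rewrite yE zE addrA.
- case=> y1 [y2 [[c [z [c0 k1 y1E]] k2 yE]]].
  exists c, (fun o j => z o j + y2 o j); split=> //.
    by apply/IH; exists z, y2.
  by move=> o j; rewrite yE y1E addrA.
Qed.

Lemma poscomb_ge0 ks y o j : poscomb ks y -> 0 <= y o j.
Proof.
elim: ks y => [|k ks IH] y /=; first by move->.
by case=> c [z [c0 /IH z0 ->]]; rewrite addr_ge0 ?mulr_ge0 // ltW.
Qed.

Lemma poscomb_eq0 ks y o j : poscomb ks y ->
  (forall k, k \in ks -> ~~ in_tube k o j) -> y o j = 0.
Proof.
elim: ks y => [|k ks IH] y /=; first by move->.
case=> c [z [c0 kz ->]] nk.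
rewrite (negbTE (nk k _)) ?mem_head // mulr0 add0r (IH z) // => k' k'ks.
by apply: nk; rewrite inE k'ks orbT.
Qed.

Lemma poscomb_gt0 ks y o j k :
  poscomb ks y -> k \in ks -> in_tube k o j -> 0 < y o j.
Proof.
elim: ks y => [//|k1 ks IH] y /= [c [z [c0 kz ->]]].
rewrite inE => /orP[/eqP<- ->|kks kj].
  by rewrite mulr1 ltr_pwDl // (poscomb_ge0 _ _ kz).
by rewrite ltr_wpDl ?(IH z) // mulr_ge0 // ltW.
Qed.

Lemma poscomb_range s F y o j : poscomb (ftubes s F) y ->
  ~~ in_tube (s, fleaves F, [set: G]%SET) o j -> y o j = 0.
Proof.
move=> Fy nj; apply: (poscomb_eq0 Fy) => k kF; apply: contra nj.
exact: ftubes_range.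
Qed.

(** [y] vanishes at the gap after [T] but is positive on every gap inside [T'], so [T'] cannot
    extend beyond [T]. *)
Lemma first_leaves_le s T F T' F' y : pebble_tree T -> pebble_tree T' ->
  poscomb (ftubes s (T :: F)) y -> poscomb (ftubes s (T' :: F')) y ->
  (leaves T' <= leaves T)%N.
Proof.
move=> okT okT' Fy F'y; rewrite leqNgt; apply/negP => lt.
have y0 : y None (s + leaves T).-1 = 0.
  by apply: (poscomb_eq0 Fy) => k; apply: gap_avoids_ftubes.
case: T' okT' F'y lt => [|p ch] okT' F'y lt.
  by move: (leaves_gt0 okT) lt => /=; lia.
have : 0 < y None (s + leaves T).-1.
  apply: (poscomb_gt0 (k := tube (s, Node p ch)) F'y);
    first by rewrite ftubes_node mem_head.
  by move: (leaves_gt0 okT) lt; rewrite /in_tube /tube [(_, _).1]/= [(_,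
    _).2]/=; lia.
by rewrite y0 ltxx.
Qed.

(** For a color unbalanced in [T], [y] vanishes at some leaf of [T]; for a color balanced in [T'],
    it is positive at all of these leaves. *)
Lemma first_balanced_sub s T F T' F' y :
  pebble_tree T -> pebble_tree T' -> leaves T' = leaves T ->
  poscomb (ftubes s (T :: F)) y -> poscomb (ftubes s (T' :: F')) y ->
  balanced_colors T' \subset balanced_colors T.
Proof.
move=> okT okT' eL Fy F'y; apply/fintype.subsetP => g gT'; rewrite inE;
  apply/negPn/negP => gT.
have ub : (0 < unbalanced g [:: T])%N by rewrite /unbalanced /= gT.
have [|j jT Hj] := @unbalanced_avoids_ftubes _ s [:: T] g _ ub;
  first by rewrite /= okT.
move: jT; rewrite /fleaves /= addn0 => jT.
have y0 : y (Some g) j = 0.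
  apply: (poscomb_eq0 Fy) => k; rewrite ftubes_cons mem_cat => /orP[/Hj//|kF].
  by apply/negP => /(ftubes_range kF) /=; lia.
case: T' okT' eL gT' F'y => [|p ch] okT' eL gT' F'y;
  first by rewrite inE in gT'.
have : 0 < y (Some g) j.
  apply: (poscomb_gt0 (k := tube (s, Node p ch)) F'y);
    first by rewrite ftubes_node mem_head.
  by rewrite /in_tube /tube [(_, _).1]/= [(_, _).2]/= gT' eL.
by rewrite y0 ltxx.
Qed.

Lemma first_tube_eq s T F T' F' y : pebble_tree T -> pebble_tree T' ->
  poscomb (ftubes s (T :: F)) y -> poscomb (ftubes s (T' :: F')) y ->
  tube (s, T) = tube (s, T').
Proof.
move=> okT okT' Fy F'y.
have eL : leaves T = leaves T'.
  apply/eqP; rewrite eqn_leq (first_leaves_le okT' okT F'y Fy).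
  by rewrite (first_leaves_le okT okT' Fy F'y).
congr (_, _, _) => //=; apply/eqP; rewrite finset.eqEsubset.
by rewrite (first_balanced_sub okT' okT eL F'y Fy)
           (first_balanced_sub okT okT' (esym eL) Fy F'y).
Qed.

(** At the coordinate avoided by all proper subtrees only the root contributes, the siblings living
    outside its range. Its coefficient is thus attained on its tube. *)
Lemma node_minimum s p ch F c z1 z2 : pebble_tree (Node p ch) ->
  poscomb (ftubes s ch) z1 -> poscomb (ftubes (s + fleaves ch)%N F) z2 ->
  exists o j, in_tube (tube (s, Node p ch)) o j /\
    c * (in_tube (tube (s, Node p ch)) o j)%:R + (z1 o j + z2 o j) = c.
Proof.
move=> okN k1 k2; have [o [j [oj noj]]] := node_avoids_ftubes s okN.
exists o, j; split => //; rewrite oj mulr1 (poscomb_eq0 k1) //.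
rewrite (poscomb_range k2) ?addr0 //.
by move: oj; case: o {noj} => [g|] /=; rewrite -/(fleaves ch) ?finset.inE; lia.
Qed.

Lemma eq_cat_range s m F F' y1 y2 y1' y2' : fleaves F = m -> fleaves F' = m ->
  poscomb (ftubes s F) y1 -> poscomb (ftubes s F') y1' ->
  (forall o j, in_tube (s, m, [set: G]%SET) o j -> y2 o j = 0) ->
  (forall o j, in_tube (s, m, [set: G]%SET) o j -> y2' o j = 0) ->
  (forall o j, y1 o j + y2 o j = y1' o j + y2' o j) ->
  forall o j, y1 o j = y1' o j.
Proof.
move=> eF eF' k1 k1' z2 z2' E o j.
have [r|r] := boolP (in_tube (s, m, [set: G]%SET) o j).
  by have := E o j; rewrite z2 // z2' // !addr0.
by rewrite (poscomb_range k1) ?eF // (poscomb_range k1') ?eF'.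
Qed.

Lemma poscomb_forest_inj s F F' y :
  all (@pebble_tree G) F -> all (@pebble_tree G) F' -> fleaves F = fleaves F' ->
  poscomb (ftubes s F) y -> poscomb (ftubes s F') y -> F = F'.
Proof.
elim/forest_ind: F s F' y => [|F IH|p ch F IHch IHF] s F' y.
- by move=> _ okF' eL _ _; move: (size_fleaves okF'); rewrite -eL;
  case: F' {okF' eL}.
- case: F' => [|[|p' ch'] F'] okF okF' eL.
  + by have := size_fleaves okF; rewrite eL.
  + move: okF okF' => /andP[_ okF] /andP[_ okF'].
    rewrite !ftubes_leaf => Fy F'y; congr cons.
    apply: (IH s.+1 F' y okF okF') => //.
    by move: eL; rewrite /fleaves /= => -[].
  (* A leaf cannot face a node: equal tubes would give a node with one leaf and no balanced
     color. *)
  + move=> Fy F'y; have /andP[okN _] := okF'.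
    have E := first_tube_eq (pebble_tree_leaf G) okN Fy F'y.
    have [] := node1_balanced okN; first by case: E.
    by move=> g; case: E => _ <-; rewrite inE.
case: F' => [|[|p' ch'] F'] okF okF' eL.
- by have := size_fleaves okF; rewrite eL.
- move=> Fy F'y; have /andP[okN _] := okF.
  have E := first_tube_eq okN (pebble_tree_leaf G) Fy F'y.
  have [] := node1_balanced okN; first by case: E.
  by move=> g; case: E => _ ->; rewrite inE.
move=> Fy F'y.
have /andP[okN {}okF] := okF; have /andP[okN' {}okF'] := okF'.
have E := first_tube_eq okN okN' Fy F'y.
have [eLc eB] : fleaves ch = fleaves ch' /\
  balanced_colors (Node p ch) = balanced_colors (Node p' ch') by case: E.
have okch : all (@pebble_tree G) ch by move: okN;
  rewrite pebble_treeE => /and3P[].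
have okch' : all (@pebble_tree G) ch' by move: okN';
  rewrite pebble_treeE => /and3P[].
move: Fy F'y; rewrite !ftubes_node -E -eLc.
case=> c [z [c0 /poscomb_cat[z1 [z2 [k1 k2 zE]]] yE]].
case=> c' [z' [c0' /poscomb_cat[z1' [z2' [k1' k2' zE']]] yE']].
(* Where the second combination attains [c'], the first one equals [c] plus nonnegative terms, and
   symmetrically. *)
have cc' : c = c'.
  apply/eqP; rewrite eq_le; apply/andP; split.
    rewrite eLc in k2'.
    have [o [j [oj <-]]] := node_minimum c' okN' k1' k2'.
    have := yE o j; rewrite yE' zE' E zE oj !mulr1 => ->.
    by rewrite lerDl addr_ge0 // (poscomb_ge0 _ _ k1, poscomb_ge0 _ _ k2).
  have [o [j [oj <-]]] := node_minimum c okN k1 k2.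
  have := yE' o j; rewrite yE zE zE' oj !mulr1 => ->.
  by rewrite lerDl addr_ge0 // (poscomb_ge0 _ _ k1', poscomb_ge0 _ _ k2').
have zz o j : z1 o j + z2 o j = z1' o j + z2' o j.
  by rewrite -zE -zE'; have := yE o j; rewrite yE' cc' => /addrI.
have out w F0 : poscomb (ftubes (s + fleaves ch)%N F0) w ->
    forall o j, in_tube (s, fleaves ch, [set: G]%SET) o j -> w o j = 0.
  move=> kw o j r; apply: (poscomb_range kw); move: r.
  by case: o => [g|] /=; rewrite ?finset.inE; lia.
have z11 := eq_cat_range (erefl _) (esym eLc) k1 k1' (out _ _ k2) (out _ _ k2')
  zz.
have z22 o j : z2 o j = z2' o j by have := zz o j; rewrite z11 => /addrI.
have ech : ch = ch'.
  by apply: (IHch s ch' z1) => //; apply: poscomb_ext k1' => o j; rewrite z11.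
have eF : F = F'.
  apply: (IHF (s + fleaves ch)%N F' z2 okF okF') => //.
    by move: eL; rewrite /fleaves /= -!/(fleaves _) ech; lia.
  by apply: poscomb_ext k2' => o j; rewrite z22.
(* By [Delta_node] the pebbles on the root are determined by the children and by [Delta g], which is
   0 or 1 and hence fixed by the balanced colors. *)
rewrite -eF -ech; congr (Node _ _ :: _); apply/ffunP => g.
have : (g \in balanced_colors (Node p ch)) = (g \in balanced_colors (Node p'
  ch')) by rewrite eB.
rewrite !inE -ech !Delta_node //.
move: okN okN'; rewrite -ech !pebble_treeE => /and3P[_ /forallP/(_ g) + _]
  /and3P[_ /forallP/(_ g) + _].
rewrite !Delta_node //; lia.
Qed.

End PositiveCombinations.

(** * Existence of the forest of a nonnegative function *)

Section Existence.
Variables (R : realFieldType) (G : finType).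
Implicit Types (T S : ptree G) (F ch : seq (ptree G)) (g : G) (o : option G).
Implicit Types (y z : option G -> nat -> R).

Lemma balanced_covers s F g j : unbalanced g F = 0%N ->
  (s <= j < s + fleaves F)%N ->
  exists2 k, k \in ftubes s F & in_tube k (Some g) j.
Proof.
elim: F s => [|T F IH] s ub jF; first by move: jF; rewrite /fleaves /=; lia.
move: ub; rewrite /unbalanced /= => ub.
have /eqP T0 : Delta g T == 0 by move: ub; case: eqP.
have {}ub : unbalanced g F = 0%N by move: ub; rewrite /unbalanced; lia.
case: T T0 jF => [//|p ch] T0 jF.
have [jT|jT] := ltnP j (s + leaves (Node p ch)).
  exists (tube (s, Node p ch)); first by rewrite ftubes_node mem_head.
  by rewrite /in_tube /tube [(_, _).1]/= [(_, _).2]/= finset.inE T0 eqxx jT;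
    lia.
have [|k kF kj] := IH (s + leaves (Node p ch))%N ub.
  by move: jF jT; rewrite /fleaves /=; lia.
by exists k => //; rewrite ftubes_cons mem_cat kF orbT.
Qed.

(** A zero of [y] at a colored leaf forces an unbalanced tree for that color, since balanced trees
    would cover all leaves. The last zero provides the pebble needed above a single child. *)
Lemma node_of_forest s ch y (B : {set G}) : all (@pebble_tree G) ch ->
  (0 < size ch)%N -> poscomb (ftubes s ch) y ->
  (forall g, g \notin B ->
     exists2 j, (s <= j < s + fleaves ch)%N & y (Some g) j = 0) ->
  (exists o j, in_tube (s, fleaves ch, B) o j /\ y o j = 0) ->
  exists p, pebble_tree (Node p ch) /\ balanced_colors (Node p ch) = B.
Proof.
move=> okch ch0 chy zB [o0 [j0 [j0B y0]]].
have ub g j : (s <= j < s + fleaves ch)%N -> y (Some g) j = 0 ->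
    (0 < unbalanced g ch)%N.
  move=> jr yj; rewrite lt0n; apply/eqP => /balanced_covers /(_ jr)[k kch kj].
  by have := poscomb_gt0 chy kch kj; rewrite yj ltxx.
(* The choice forced by [Delta_node] for [Delta] to be 0 on [B] and 1 off [B]. The subtraction is
   exact because colors off [B] have an unbalanced tree. *)
pose p := [ffun g => (unbalanced g ch - (g \notin B))%N].
have DN g : Delta g (Node p ch) = (g \notin B)%:Z.
  rewrite Delta_node // ffunE.
  suff : ((g \notin B) <= unbalanced g ch)%N by lia.
  by case: (boolP (g \in B)) => //= /zB[j jr /(ub g j jr)].
exists p; split; last by apply/setP => g; rewrite finset.inE DN;
  case: (g \in B).
rewrite pebble_treeE okch andbT; apply/andP; split; last first.
  by apply/forallP => g; rewrite DN; case: (g \in B).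
rewrite /= ch0 /=; apply/implyP => /eqP ch1.
case: o0 j0B y0 => [g|] /=.
  case/andP => gB jr /(ub g _ jr) ug.
  rewrite lt0n sum_nat_eq0 negb_forall; apply/existsP; exists g.
  by rewrite implyTb ffunE gB /= subn0 -lt0n.
(* A single tree covers all its gaps, so the zero cannot be a gap. *)
move=> j0r y0; suff [] : False.
case: ch ch1 {okch ch0 zB ub p DN} chy j0r => [//|[|p ch] [|//]] _.
  by rewrite /fleaves /=; lia.
move=> chy; rewrite /fleaves /= addn0 => j0r.
suff : 0 < y None j0 by rewrite y0 ltxx.
apply: (poscomb_gt0 (k := tube (s, Node p ch)) chy) => //.
by rewrite ftubes_node mem_head.
Qed.

Let support N y := [set e : option G * 'I_N | 0 < y e.1 e.2]%SET.

(** [N] bounds the leaf numbers and makes the support finite. The induction is on the size of the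
    support plus the number of leaves: cutting at a zero gap lowers the latter, subtracting the
    minimum on the tube of the root lowers the former. *)
Lemma poscomb_exists_bounded N k s n y : (s + n <= N)%N ->
  (#|support N y| + n <= k)%N -> (forall o j, 0 <= y o j) ->
  (forall o j, ~~ in_tube (s, n, [set: G]%SET) o j -> y o j = 0) ->
  exists F, [/\ all (@pebble_tree G) F, fleaves F = n & poscomb (ftubes s F) y].
Proof.
elim: k s n y => [|k IH] s [|n] y sN.
- move=> _ _ y0; exists [::]; split=> //= o j; apply: y0.
  by case: o => [g|] /=; rewrite ?finset.inE; lia.
- by rewrite addnS.
- move=> _ _ y0; exists [::]; split=> //= o j; apply: y0.
  by case: o => [g|] /=; rewrite ?finset.inE; lia.
move=> cnt y_ge0 y0.
have sub z : (forall o j, 0 < z o j -> 0 < y o j) ->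
    (#|support N z| <= #|support N y|)%N.
  by move=> zy; apply/subset_leq_card/fintype.subsetP => e;
    rewrite !finset.inE; apply: zy.
have [/existsP[m /andP[m0 /eqP ym]]|/existsPn gaps] :=
    boolP [exists m : 'I_n.+1, (0 < m)%N && (y None (s + m).-1 == 0)].
  (* Here [y] vanishes at the gap after the first [m] leaves and is cut there into two functions. *)
  pose cut (a b : nat) o j := if in_tube (a, b,
    [set: G]%SET) o j then y o j else 0.
  have cut_ge0 a b o j : 0 <= cut a b o j by rewrite /cut; case: ifP.
  have cut0 a b o j : ~~ in_tube (a, b, [set: G]%SET) o j -> cut a b o j = 0.
    by rewrite /cut => /negbTE ->.
  have cutS a b : (#|support N (cut a b)| <= #|support N y|)%N.
    by apply: sub => o j; rewrite /cut; case: ifP; rewrite ?ltxx.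
  have mn := ltn_ord m.
  have [||F1 [ok1 L1 k1]] := IH s m (cut s m) _ _ (cut_ge0 s m) (cut0 s m).
  - by lia.
  - by have := cutS s m; lia.
  have [||F2 [ok2 L2 k2]] := IH (s + m)%N (n.+1 - m)%N _ _ _
      (cut_ge0 (s + m)%N (n.+1 - m)%N) (cut0 (s + m)%N (n.+1 - m)%N).
  - by lia.
  - by have := cutS (s + m)%N (n.+1 - m)%N; lia.
  exists (F1 ++ F2); split; first by rewrite all_cat ok1.
    by rewrite fleaves_cat L1 L2; lia.
  rewrite ftubes_cat L1; apply/poscomb_cat.
  exists (cut s m), (cut (s + m)%N (n.+1 - m)%N); split=> // o j.
  rewrite /cut; have [a|a] := boolP (in_tube (s, val m, _) o j);
    have [b|b] := boolP (in_tube (s + m, n.+1 - m, _)%N o j).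
  + by exfalso; move: a b; case: o => [g|] /=; rewrite ?finset.inE; lia.
  + by rewrite addr0.
  + by rewrite add0r.
  rewrite addr0; have [c|/y0 //] := boolP (in_tube (s, n.+1, [set: G]%SET) o j).
  case: o a b c => [g|] /=; rewrite ?finset.inE; first by lia.
  by move=> a b c; rewrite -ym; congr (y None _); lia.
pose B := [set g | [forall j : 'I_n.+1, 0 < y (Some g) (s + j)%N]]%SET.
have zB g : g \notin B -> exists2 j, (s <= j < s + n.+1)%N & y (Some g) j = 0.
  rewrite finset.inE negb_forall => /existsP[j]; rewrite -leNgt => yj.
  exists (s + j)%N; first by have := ltn_ord j; lia.
  by apply/eqP; rewrite eq_le yj y_ge0.
have posB o j : in_tube (s, n.+1, B) o j -> 0 < y o j.
  case: o => [g|] /=.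
    rewrite finset.inE => /andP[/forallP gB jr].
    have jn : (j - s < n.+1)%N by lia.
    by have := gB (Ordinal jn); rewrite /= subnKC //; lia.
  move=> jr; have jn : (j.+1 - s < n.+1)%N by lia.
  have := gaps (Ordinal jn); rewrite /= negb_and -leqNgt => /orP[|];
    first by lia.
  have -> : (s + (j.+1 - s)).-1 = j by lia.
  by move=> nz; rewrite lt_neqAle eq_sym nz y_ge0.
(* If the tube has no coordinate, there is one leaf and no color in [B]; then [y] is zero and the
   forest is a leaf. *)
have [e0 e0B|noB] := pickP (fun e : option G * 'I_N => in_tube (s, n.+1,
  B) e.1 e.2); last first.
  have n0 : n = 0%N.
    apply/eqP; rewrite -leqn0 leqNgt; apply/negP => n0.
    have sn : (s < N)%N by lia.
    by have := noB (None, Ordinal sn); rewrite /=; lia.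
  exists [:: Leaf]; split; rewrite ?n0 //=; first by rewrite pebble_tree_leaf.
  move=> o j; have [r|/y0//] := boolP (in_tube (s, n.+1, [set: G]%SET) o j).
  case: o r => [g|] /=; rewrite n0; last by lia.
  rewrite finset.inE => jr; have -> : j = s by lia.
  have [|i ir <-] := zB g; last by congr (y _ _); lia.
  apply/negP => gB; have sn : (s < N)%N by lia.
  by have := noB (Some g, Ordinal sn); rewrite /= gB; lia.
case: (@arg_minP _ R _ e0 (fun e : option G * 'I_N => in_tube (s, n.+1,
  B) e.1 e.2)
  (fun e => y e.1 e.2) e0B) => {e0B}e eB emin.
set c := y e.1 e.2 in emin.
have c0 : 0 < c by apply: posB.
pose y' o j := y o j - c * (in_tube (s, n.+1, B) o j)%:R.
have inN o j : in_tube (s, n.+1, B) o j -> (j < N)%N.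
  by case: o => [g|] /=; lia.
have [|||ch [okch Lch ky]] := IH s n.+1 y' sN.
- suff : (#|support N y'| < #|support N y|)%N by lia.
  apply/proper_card/fintype.properP; split.
    apply/fintype.subsetP => f; rewrite !finset.inE /y' => f0.
    by apply: lt_le_trans f0 _; rewrite lerBlDr lerDl mulr_ge0 // ltW.
  exists e; rewrite finset.inE; first exact: posB.
  by rewrite /y' eB mulr1 subrr ltxx.
- move=> o j; rewrite /y'; have [oj|_] := boolP (in_tube _ o j);
  last by rewrite mulr0 subr0.
  by rewrite mulr1 subr_ge0; apply: (emin (o, Ordinal (inN o j oj))).
- move=> o j noj; rewrite /y' y0 // (_ : in_tube _ o j = false) ?mulr0 ?subr0
  //.
  by apply/negbTE; apply: contra noj; case: o => [g|] /=; rewrite ?finset.inE;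
    lia.
have [|||p [okN BN]] := @node_of_forest s ch y' B okch _ ky.
- by rewrite lt0n; case: (ch) Lch.
- move=> g gB; have [j jr yj] := zB g gB; exists j; first by rewrite Lch.
  by rewrite /y' yj /= (negbTE gB) mulr0 subr0.
- exists e.1, e.2; split; first by rewrite Lch.
  by rewrite /y' eB mulr1 subrr.
exists [:: Node p ch]; split; first by rewrite /= okN.
  by rewrite /fleaves /= -/(fleaves _) Lch addn0.
rewrite ftubes_node /= cats0; exists c, y'; split => // o j.
by rewrite /tube /= -/(fleaves _) Lch BN /y' addrC subrK.
Qed.

Lemma poscomb_exists s n y : (forall o j, 0 <= y o j) ->
  (forall o j, ~~ in_tube (s, n, [set: G]%SET) o j -> y o j = 0) ->
  exists F, [/\ all (@pebble_tree G) F, fleaves F = n & poscomb (ftubes s F) y].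
Proof. exact: (poscomb_exists_bounded (leqnn _) (leqnn _)). Qed.

End Existence.

(** * Contractions *)

Section Contraction.
Variable G : finType.
Implicit Types (T S : ptree G) (F ch l r : seq (ptree G)) (g : G).
Implicit Types (k : nat * nat * {set G}) (ks : seq (nat * nat * {set G})).

Lemma contraction_leaves T T' : contraction T T' -> leaves T' = leaves T.
Proof.
elim=> [p l q ch r|p l S S' r _ IH] /=; rewrite !map_cat /= !sumn_cat /= ?IH //.
Qed.

Lemma contraction_pebbles T T' g :
  contraction T T' -> pebbles g T' = pebbles g T.
Proof.
elim=> [p l q ch r|p l S S' r _ IH] /=; rewrite !map_cat /= !sumn_cat /= ?IH //.
by rewrite ffunE; lia.
Qed.

Lemma contraction_Delta T T' g : contraction T T' -> Delta g T' = Delta g T.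
Proof.
by move=> TT'; rewrite /Delta (contraction_leaves TT') (contraction_pebbles _
  TT').
Qed.

Lemma contraction_tube T T' s : contraction T T' -> tube (s, T') = tube (s, T).
Proof.
move=> TT'; rewrite /tube /= (contraction_leaves TT'); congr (_, _, _).
by apply/setP => g; rewrite !finset.inE (contraction_Delta _ TT').
Qed.

Lemma contraction_pebble_tree T T' :
  contraction T T' -> pebble_tree T -> pebble_tree T'.
Proof.
move=> TT'; have D01 : Delta01 T' = Delta01 T.
  by apply: eq_forallb => g; rewrite (contraction_Delta _ TT').
rewrite !pebble_treeE D01 => /and3P[+ ->].
elim: TT' {D01} => [p l q ch r|p l S S' r SS' IH] /=;
  rewrite !all_cat /= !size_cat /=.
  move=> okp /and3P[-> okq ->]; move: okq.
  rewrite pebble_treeE /= => /and3P[/andP[ch0 okq] _ ->].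
  rewrite /= !andbT; apply/andP; split; first by lia.
  (* If the merged node has one child, so had the contracted node, whose pebble moves to the
     parent. *)
  apply/implyP => sz1; have {}sz1 : size ch == 1%N by lia.
  move: okq; rewrite sz1 implyTb !lt0n !sum_nat_eq0 !negb_forall => /existsP[g
    qg].
  by apply/existsP; exists g; move: qg; rewrite !implyTb ffunE; lia.
move=> -> /and3P[-> okS ->]; rewrite andbT /=.
move: okS; rewrite !pebble_treeE => /and3P[okS DS okch]; apply/and3P; split.
- by have /andP[] := IH okS okch.
- suff -> : Delta01 S' = Delta01 S by [].
  by apply: eq_forallb => g; rewrite (contraction_Delta _ SS').
- by have /andP[] := IH okS okch.
Qed.

Lemma ftubes_cat_cons s l T r : ftubes s (l ++ T :: r) =
  ftubes s l ++ ftubes (s + fleaves l)%N [:: T] ++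
  ftubes (s + fleaves l + leaves T)%N r.
Proof. by rewrite ftubes_cat (ftubes_cons _ T). Qed.

Lemma ftubes1 s T :
  is_node T -> ftubes s [:: T] = tube (s, T) :: ftubes s (children T).
Proof. by case: T => // p ch _; rewrite ftubes_node cats0. Qed.

Lemma contraction_is_node T T' : contraction T T' -> is_node T && is_node T'.
Proof. by case. Qed.

(** Contraction preserves the leaves and pebbles of the subtrees above the contracted node, hence
    their tubes; only the tube of that node is lost. *)
Lemma contraction_drops_tube T T' s : contraction T T' ->
  exists k ks1 ks2, ftubes s (children T) = ks1 ++ k :: ks2 /\
                    ftubes s (children T') = ks1 ++ ks2.
Proof.
move=> TT'; elim: TT' s => [p l q ch r|p l S S' r SS' IH] s /=.
  rewrite ftubes_cat_cons ftubes1 // !ftubes_cat /=.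
  by do 3!eexists.
have [k [ks1 [ks2 [E E']]]] := IH (s + fleaves l)%N.
have /andP[nS nS'] := contraction_is_node SS'.
exists k, (ftubes s l ++ tube (s + fleaves l, S)%N :: ks1).
exists (ks2 ++ ftubes (s + fleaves l + leaves S)%N r).
rewrite !ftubes_cat_cons !ftubes1 // E E' (contraction_tube _ SS').
by rewrite (contraction_leaves SS') -!catA /= -!catA.
Qed.

(** The forest is seen as the last children of a node, because a tree of the forest is contracted
    into that node and changes its pebbles. Moving the first tree into [l] gives access to its right
    siblings. *)
Lemma drop_tube_forest F s ks1 k ks2 : ftubes s F = ks1 ++ k :: ks2 ->
  forall p l, exists p' F',
    [/\ contraction (Node p (l ++ F)) (Node p' (l ++ F')),
    fleaves F' = fleaves F & ftubes s F' = ks1 ++ ks2].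
Proof.
elim/forest_ind: F s ks1 k ks2 => [|F IH|q ch F IHch IHF] s ks1 k ks2.
- by case: ks1.
- rewrite ftubes_leaf => /IH{}IH p l.
  have [p' [F' [c eL eF]]] := IH p (rcons l Leaf).
  exists p', (Leaf :: F'); rewrite ftubes_leaf; split=> //.
    by rewrite -!cat_rcons.
  by rewrite /fleaves /= -!/(fleaves _) eL.
rewrite ftubes_node; case: ks1 => [[_ E]|k1 ks1 [<- E]] p l.
  exists [ffun g => (p g + q g)%N], (ch ++ F); split;
    first exact: contraction_child.
    by rewrite fleaves_cat.
  by rewrite ftubes_cat E.
(* The position of [k] tells whether to contract below the first node or among its right
   siblings. *)
have [lt|ge] := ltnP (size ks1) (size (ftubes s ch)).
  have [ks3 [Ech E2]] : exists ks3, ftubes s ch = ks1 ++ k :: ks3 /\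
      ks2 = ks3 ++ ftubes (s + fleaves ch)%N F.
    exists (drop (size ks1).+1 (ftubes s ch)).
    have E1 : take (size ks1) (ftubes s ch) = ks1.
      have := congr1 (take (size ks1)) E.
      by rewrite takel_cat ?(ltnW lt) // take_size_cat.
    have E3 : drop (size ks1) (ftubes s ch) = k :: drop (size ks1).+1 (ftubes s
      ch).
      rewrite (drop_nth k lt); congr cons.
      have := congr1 (fun x => nth k x (size ks1)) E.
      by rewrite nth_cat lt nth_cat ltnn subnn.
    split; first by rewrite -{1}(cat_take_drop (size ks1) (ftubes s ch)) E1 E3.
    have : drop (size ks1) (ftubes s ch ++ ftubes (s + fleaves ch)%N F) = k ::
      ks2.
      by rewrite E drop_size_cat.
    by rewrite drop_cat lt E3 => -[].
  have [q' [ch' [c eL eF]]] := IHch s ks1 k ks3 Ech q [::].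
  exists p, (Node q' ch' :: F); split.
  - exact: contraction_below.
  - by rewrite /fleaves /= -!/(fleaves _) eL.
  - by rewrite ftubes_node (contraction_tube s c) eF eL E2 /= -catA.
have [ks3 [EF E2]] : exists ks3,
  ftubes (s + fleaves ch)%N F = ks3 ++ k :: ks2 /\
    ks1 = ftubes s ch ++ ks3.
  exists (drop (size (ftubes s ch)) ks1).
  have E1 : take (size (ftubes s ch)) ks1 = ftubes s ch.
    have := congr1 (take (size (ftubes s ch))) E.
    by rewrite take_size_cat // takel_cat.
  split; last by rewrite -{1}(cat_take_drop (size (ftubes s ch)) ks1) E1.
  have : ftubes (s + fleaves ch)%N F = drop (size (ftubes s ch)) (ks1 ++ k ::
    ks2).
    by rewrite -E drop_size_cat.
  rewrite drop_cat; case: ltnP => // ge'.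
  have -> : size (ftubes s ch) = size ks1 by apply/eqP; rewrite eqn_leq ge ge'.
  by rewrite subnn drop0 drop_size.
have [p' [F' [c eL eF]]] := IHF _ _ _ _ EF p (rcons l (Node q ch)).
exists p', (Node q ch :: F'); split; first by rewrite -!cat_rcons.
  by rewrite /fleaves /= -!/(fleaves _) eL.
by rewrite ftubes_node eF E2 /= catA.
Qed.

Lemma drop_tube T s ks1 k ks2 : ftubes s (children T) = ks1 ++ k :: ks2 ->
  exists2 T', contraction T T' & ftubes s (children T') = ks1 ++ ks2.
Proof.
case: T => [|p ch] /=; first by case: ks1.
case/drop_tube_forest/(_ p [::]) => p' [ch' [c _ e]].
by exists (Node p' ch').
Qed.

Lemma proper_subseq_drop (A : eqType) (s1 s2 : seq A) :
  subseq s1 s2 -> s1 <> s2 ->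
  exists x t1 t2, s2 = t1 ++ x :: t2 /\ subseq s1 (t1 ++ t2).
Proof.
elim: s2 s1 => [|x s2 IH] [|x1 s1] //=.
  by move=> _ _; exists x, [::], s2; split=> //; apply: sub0seq.
case: eqP => [->|ne] ss neq; last by exists x, [::], s2.
have [|y [t1 [t2 [-> s12]]]] := IH s1 ss; first by move=> E; apply: neq;
  rewrite E.
by exists y, (x :: t1), t2; split=> //=; rewrite eqxx.
Qed.

Lemma subseq_contraction s T ks : subseq ks (ftubes s (children T)) ->
  exists2 T', contraction_le T' T & ftubes s (children T') = ks.
Proof.
have [m] := ubnP (size (ftubes s (children T))).
elim: m T => // m IH T szT ss.
have [->|/eqP ne] := eqVneq ks (ftubes s (children T)).
  by exists T => //; apply: Relation_Operators.rt_refl.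
have [k [ks1 [ks2 [E ss']]]] := proper_subseq_drop ss ne.
have [T1 TT1 E1] := drop_tube E.
have [||T' T'T1 <-] := IH T1; rewrite ?E1 //.
  by move: szT; rewrite E !size_cat /= addnS ltnS.
exists T' => //; apply: Relation_Operators.rt_trans T'T1.
exact: Relation_Operators.rt_step.
Qed.

Lemma contraction_le_subseq s T' T : contraction_le T' T ->
  subseq (ftubes s (children T')) (ftubes s (children T)).
Proof.
elim=> [T1 T2 TT|//|T1 T2 T3 _ ss _ ss']; last exact: subseq_trans ss' ss.
have [k [ks1 [ks2 [-> ->]]]] := contraction_drops_tube s TT.
by apply: cat_subseq => //; apply: subseq_cons.
Qed.

Lemma contraction_le_pebble_tree T' T : contraction_le T' T ->
  pebble_tree T -> [/\ pebble_tree T', leaves T' = leaves T &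
    forall g, Delta g T' = Delta g T].
Proof.
elim=> [T1 T2 TT okT|//|T1 T2 T3 _ IH1 _ IH2 /IH1[ok2 L2 D2]].
  split; [exact: contraction_pebble_tree TT okT|exact: contraction_leaves|].
  by move=> g; apply: contraction_Delta.
have [ok3 L3 D3] := IH2 ok2; split; rewrite // ?L3 // => g.
by rewrite D3.
Qed.

End Contraction.

(** * Cones *)

Section Cones.
Variables (R : realType) (n : nat).
Local Notation V := 'rV[R]_n.
Implicit Types (s : seq V) (v x a : V).

Lemma dotDr a x v : dot a (x + v) = dot a x + dot a v.
Proof. by rewrite -big_split; apply: eq_bigr => j _; rewrite mxE mulrDr. Qed.

Lemma dotZr a (c : R) x : dot a (c *: x) = c * dot a x.
Proof. by rewrite mulr_sumr; apply: eq_bigr => j _; rewrite mxE mulrCA. Qed.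

Lemma dot0r a : dot a 0 = 0.
Proof. by rewrite [LHS]big1 // => j _; rewrite mxE mulr0. Qed.

Lemma cone_nil x : cone [::] x <-> x = 0.
Proof.
split=> [[c [_ ->]]|->]; first by rewrite big_ord0.
by exists (fun=> 0); rewrite big_ord0.
Qed.

Lemma cone_cons v s x : cone (v :: s) x <->
  exists c z, [/\ 0 <= c, cone s z & x = c *: v + z].
Proof.
split=> [[c [c0 ->]]|[c [_ [c0 [d [d0 ->]] ->]]]].
  exists (c ord0), (\sum_(i < size s) c (lift ord0 i) *: s`_i).
  split=> //; first by exists (fun i => c (lift ord0 i)).
  by rewrite big_ord_recl; congr (_ + _); apply: eq_bigr.
exists (fun i => if unlift ord0 i is Some j then d j else c).
split; first by move=> i; case: unliftP.
rewrite big_ord_recl unlift_none; congr (_ + _).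
by apply: eq_bigr => i _; rewrite liftK.
Qed.

Lemma cone0 s : cone s 0.
Proof.
elim: s => [|v s IH]; first exact/cone_nil.
by apply/cone_cons; exists 0, 0; rewrite scale0r addr0.
Qed.

Lemma coneD s x v : cone s x -> cone s v -> cone s (x + v).
Proof.
move=> [c [c0 ->]] [d [d0 ->]]; exists (fun i => c i + d i).
split=> [i|]; first by rewrite addr_ge0.
by rewrite -big_split; apply: eq_bigr => i _; rewrite scalerDl.
Qed.

Lemma coneZ s (c : R) x : 0 <= c -> cone s x -> cone s (c *: x).
Proof.
move=> c0 [d [d0 ->]]; exists (fun i => c * d i).
split=> [i|]; first by rewrite mulr_ge0.
by rewrite scaler_sumr; apply: eq_bigr => i _; rewrite scalerA.
Qed.

Lemma cone_mem s v : v \in s -> cone s v.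
Proof.
elim: s => // w s IH; rewrite inE => /orP[/eqP->|/IH sv]; apply/cone_cons.
  by exists 1, 0; rewrite ler01 scale1r addr0; split=> //; apply: cone0.
by exists 0, v; rewrite scale0r add0r.
Qed.

Lemma cone_sub s s' : {subset s <= s'} -> (cone s `<=` cone s')%classic.
Proof.
elim: s => [|v s IH] ss' x; first by move/cone_nil->; apply: cone0.
case/cone_cons=> c [z [c0 sz ->]]; apply: coneD.
  by apply: coneZ => //; apply: cone_mem; apply: ss'; apply: mem_head.
by apply: IH => // w ws; apply: ss'; rewrite inE ws orbT.
Qed.

Lemma cone_filter_zero (A : Type) (f : A -> V) (P : pred A) (es : seq A) :
  (forall e, ~~ P e -> f e = 0) ->
  cone [seq f e | e <- es] = cone [seq f e | e <- es & P e].
Proof.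
move=> f0; apply/funext => x; apply/propext.
elim: es x => [//|e es IH] x /=; case: ifP => Pe.
  by split=> /cone_cons[c [z [c0 /IH kz ->]]]; apply/cone_cons; exists c, z.
rewrite -IH; split=> [/cone_cons[c [z [_ kz ->]]]|kx].
  by rewrite f0 ?Pe // scaler0 add0r.
by apply/cone_cons; exists 0, x; rewrite scale0r add0r.
Qed.

(** For a free family this is the relative interior of [cone s]. *)
Fixpoint poscone s x : Prop :=
  if s is v :: s' then exists c z, [/\ 0 < c, poscone s' z & x = c *: v + z]
  else x = 0.

Lemma poscone_cone s x : poscone s x -> cone s x.
Proof.
elim: s x => [|v s IH] x /=; first by move->; apply: cone0.
by case=> c [z [/ltW c0 /IH kz ->]]; apply/cone_cons; exists c, z.
Qed.

Lemma poscone_sum s : poscone s (\sum_(v <- s) v).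
Proof.
elim: s => [|v s IH] /=; first by rewrite big_nil.
by exists 1, (\sum_(w <- s) w); rewrite big_cons scale1r ltr01.
Qed.

(** Generators with coefficient zero are dropped. The subsequence is one of indices, so that it can
    later be realized by a contraction. *)
Lemma cone_poscone (A : eqType) (f : A -> V) ks x :
  cone [seq f k | k <- ks] x ->
  exists2 ks', subseq ks' ks & poscone [seq f k | k <- ks'] x.
Proof.
elim: ks x => [|k ks IH] x; first by move/cone_nil->; exists [::].
case/cone_cons=> c [z [c0 /IH[ks' ss kz] ->]].
move: c0; rewrite le_eqVlt => /predU1P[<-|c0].
  by exists ks'; rewrite ?scale0r ?add0r //;
    apply: subseq_trans ss (subseq_cons _ _).
by exists (k :: ks'); rewrite /= ?eqxx //; exists c, z.
Qed.

Lemma dot_cone_ge0 a s x : (forall v, v \in s -> 0 <= dot a v) ->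
  cone s x -> 0 <= dot a x.
Proof.
elim: s x => [|v s IH] x as_ge0; first by move/cone_nil->; rewrite dot0r.
case/cone_cons=> c [z [c0 /IH z0 ->]]; rewrite dotDr dotZr addr_ge0 //.
  by rewrite mulr_ge0 // as_ge0 // mem_head.
by apply: z0 => w ws; apply: as_ge0; rewrite inE ws orbT.
Qed.

(** A sum of nonnegative terms vanishes only termwise, so generators off the hyperplane have
    coefficient zero. *)
Lemma cone_hyperplane a s : (forall v, v \in s -> 0 <= dot a v) ->
  (cone s `&` [set x | dot a x = 0])%classic =
  cone [seq v <- s | dot a v == 0].
Proof.
move=> as_ge0; apply/seteqP; split=> x /=; last first.
  move=> kx; split; first by apply: cone_sub kx => v;
    rewrite mem_filter => /andP[].
  elim: s x kx {as_ge0} => [|v s IH] x /=; first by move/cone_nil->;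
    apply: dot0r.
  case: eqP => [av|_]; last exact: IH.
  by case/cone_cons=> c [z [_ /IH az ->]]; rewrite dotDr dotZr av mulr0 add0r.
case; elim: s x as_ge0 => [//|v s IH] x as_ge0 /cone_cons[c [z [c0 kz ->]]] /=.
have as_ge0' w : w \in s -> 0 <= dot a w.
  by move=> ws; apply: as_ge0; rewrite inE ws orbT.
have av : 0 <= dot a v by apply: as_ge0; apply: mem_head.
have az := dot_cone_ge0 as_ge0' kz.
rewrite dotDr dotZr => /eqP; rewrite paddr_eq0 ?mulr_ge0 // mulf_eq0.
case/andP=> /orP[/eqP c00|av0] /eqP az0.
  rewrite c00 scale0r add0r; case: ifP => _; last exact: IH.
  by apply/cone_cons; exists 0, z; rewrite scale0r add0r; split=> //; apply: IH.
by rewrite av0; apply/cone_cons; exists c, z; split=> //; apply: IH.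
Qed.

Lemma face_of_cone D s : face_of D (cone s) ->
  exists P : pred V, D = cone [seq v <- s | P v].
Proof.
case=> a [a_ge0 ->]; exists (fun v => dot a v == 0); apply: cone_hyperplane.
by move=> v /cone_mem; apply: a_ge0.
Qed.

(** The functional is a combination of the coordinate functions of [s], and its values on the
    standard basis form [a]. *)
Lemma free_dual s (d : V -> R) : free s ->
  exists a, forall v, v \in s -> dot a v = d v.
Proof.
move=> fs; pose t := in_tuple s.
exists (\row_j \sum_(i < size s) d s`_i * coord t i (delta_mx 0 j)) => v vs.
have -> : dot (\row_j \sum_(i < size s) d s`_i * coord t i (delta_mx 0 j)) v =
    \sum_(i < size s) d s`_i * coord t i v.
  rewrite /dot; under eq_bigr do rewrite mxE mulr_suml.
  rewrite exchange_big; apply: eq_bigr => i _.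
  rewrite {2}[v]row_sum_delta linear_sum mulr_sumr; apply: eq_bigr => j _.
  by rewrite linearZ /= mulrCA mulrA mulrC mulrA; ring.
have [i <-] : exists i : 'I_(size s), s`_i = v.
  have iv : (index v s < size s)%N by rewrite index_mem.
  by exists (Ordinal iv); rewrite nth_index.
rewrite (bigD1 i) //= big1 ?addr0 => [|j ne].
  by rewrite (coord_free i i) // eqxx mulr1.
by rewrite (coord_free i j) // eq_sym (negbTE ne) mulr0.
Qed.

(** The supporting functional is 0 on the kept generators and 1 on the others. *)
Lemma free_cone_face s (P : pred V) : free s ->
  face_of (cone [seq v <- s | P v]) (cone s).
Proof.
move=> /(free_dual (fun v => (~~ P v)%:R))[a aE].
have a_ge0 v : v \in s -> 0 <= dot a v by move/aE->; apply: ler0n.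
exists a; split=> [x|]; first exact: dot_cone_ge0.
rewrite cone_hyperplane //; congr cone; apply: eq_in_filter => v /aE->.
by case: (P v); rewrite ?eqxx // oner_eq0.
Qed.

End Cones.

(** * Coordinates of the rays *)

Section Rays.
Variables (R : realType) (l b u : nat).
Hypothesis l_gt0 : (0 < l)%N.
Local Notation G := 'I_(b + u).
Local Notation n := (ambient_dim l b u).
Local Notation V := 'rV[R]_n.
Implicit Types (T : ptree G) (F : seq (ptree G)) (g : G) (o : option G) (e :
  'I_n).
Implicit Types (k : nat * nat * {set G}) (ks : seq (nat * nat * {set G})).
Implicit Types (y : option G -> nat -> R).

Definition valid o j := in_tube (1%N, l, [set: G]%SET) o j.

Definition position o j : nat := if o is Some g then (l * g.+1 + j).-1 else j.

(** The inverse of [position]: divide the integer [e.+1] that [e] stands for by [l]. Quotient 0 is a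
    gap and quotient [q.+1] the color [q], where the remainder is shifted because leaves are
    numbered from 1. *)
Definition decode e : option G * nat :=
  if (e.+1 %/ l)%N is q.+1 then (insub q, (e.+1 %% l).+1) else (None,
    (e.+1 %% l)%N).

Lemma mul_lt_shift (a c : nat) : (a < c)%N -> (l * a + l <= l * c)%N.
Proof. by move=> ac; rewrite -mulnSr leq_mul2l ac orbT. Qed.

Lemma index_bound e : (e.+1 < l * (b + u).+1)%N.
Proof. by case: e => i /=; rewrite /ambient_dim addn1; lia. Qed.

Lemma decodeP e :
  valid (decode e).1 (decode e).2 /\ position (decode e).1 (decode e).2 = e.+1.
Proof.
have eE := divn_eq e.+1 l; have rl : (e.+1 %% l < l)%N by rewrite ltn_mod.
rewrite /decode; case E: (e.+1 %/ l)%N => [|q] in eE *.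
  by rewrite /valid /=; move: (e.+1 %% l)%N eE rl; lia.
have qbu : (q < b + u)%N.
  rewrite ltnNge; apply/negP => /(leq_mul (leqnn l)) qle.
  by have := index_bound e; rewrite {}eE mulnS (mulnC q.+1) mulnS; lia.
rewrite insubT /valid /position /= finset.inE; move: eE.
by rewrite mulnC; move: (e.+1 %% l)%N rl => r; lia.
Qed.

Lemma position_inj o j o' j' : valid o j -> valid o' j' ->
  position o j = position o' j' -> (o, j) = (o', j').
Proof.
rewrite /valid; case: o o' => [g|] [g'|] /=; rewrite ?finset.inE /= => jr jr' E.
- have [lt|lt|gg] := ltngtP g.+1 g'.+1.
  + by have := mul_lt_shift lt; lia.
  + by have := mul_lt_shift lt; lia.
  + have /val_inj -> : g = g' :> nat by lia.
    by congr (_, _); move: E; rewrite gg; lia.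
- by move: E; rewrite mulnS; lia.
- by move: E; rewrite mulnS; lia.
- by rewrite E.
Qed.

Lemma decode_surj o j : valid o j -> exists e, decode e = (o, j).
Proof.
move=> vj; have pn : ((position o j).-1 < n)%N.
  rewrite /ambient_dim; move: vj; rewrite /valid; case: o => [g|] /=.
    rewrite finset.inE /= => jr; have := ltn_ord g => /mul_lt_shift.
    by rewrite addn1 !mulnS; lia.
  by rewrite addn1 mulnS; lia.
exists (Ordinal pn); have [v1 p1] := decodeP (Ordinal pn).
rewrite [LHS]surjective_pairing; apply: position_inj => //; rewrite p1 /=.
by move: vj; rewrite /valid; case: (o) => [g|] /=; rewrite ?mulnS; lia.
Qed.

(** Truncated subtraction sends the first [b] colors to block 0, with the gaps; each later color is
    a block of its own. *)
Definition color_block o : nat := if o is Some g then (g.+1 - b)%N else 0%N.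
Definition index_block e : nat := color_block (decode e).1.

Lemma mem_block (i : nat) e : (e \in block l b u i) = (index_block e == i).
Proof.
have [v p] := decodeP e; rewrite /block /index_block.
case: (decode e) v p => o j /= vj pe.
case: ifP => [/eqP->|i0]; rewrite finset.inE -pe; move: vj; rewrite /valid.
  case: o {pe} => [g|] /=; rewrite ?finset.inE /= => jr;
    last by rewrite addn1 mulnS; lia.
  have [lt|le] := ltnP g b.
    by have := mul_lt_shift lt; rewrite addn1 !mulnS; lia.
  by have := leq_mul (leqnn l) le; rewrite addn1 !mulnS; lia.
case: o {pe} => [g|] /=; rewrite ?finset.inE /= => jr; last first.
  have : (0 < b + i)%N by lia.
  by case: (b + i)%N => [//|m] _; rewrite mulnS; lia.
rewrite addn1 (_ : (g.+1 - b == i)%N = (g.+1 == (b + i)%N)); last by lia.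
have [lt|lt|->] := ltngtP g.+1 (b + i)%N; rewrite mulnS.
- by have := mul_lt_shift lt; lia.
- by have := mul_lt_shift lt; lia.
- by lia.
Qed.

Lemma index_block_lt e : (index_block e < u.+1)%N.
Proof. by rewrite /index_block; case: (decode e).1 => //= g; have := ltn_ord g;
  lia. Qed.

Definition tube_in_range k := [&& 0 < k.1.1,
  0 < k.1.2 & k.1.1 + k.1.2 <= l.+1]%N.

Definition tube_set k : {set 'I_n} :=
  boxtimes l n k.1.1 (k.1.1 + k.1.2 - 1)%N k.2.

Lemma mem_tube_set k e : tube_in_range k ->
  (e \in tube_set k) = in_tube k (decode e).1 (decode e).2.
Proof.
case: k => -[s m] B /and3P[/= s0 m0 sm]; have [v p] := decodeP e.
rewrite /tube_set /boxtimes /otimes /= finset.in_setU.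
case: (decode e) v p => o j /=; rewrite /valid.
case: o => [g|] /=; rewrite ?finset.inE /= => jr p; rewrite -p.
  have -> : (s <= (l * g.+1 + j).-1 <= s + m - 1 - 1)%N = false by rewrite
    mulnS; lia.
  rewrite orFb; apply/finset.bigcupP/andP => [[g' g'B]|[gB jsm]].
    rewrite finset.inE -p => e_itv.
    have [lt|lt|gg] := ltngtP g.+1 g'.+1.
    - by have := mul_lt_shift lt; lia.
    - by have := mul_lt_shift lt; lia.
    - have /val_inj <- : g' = g :> nat by lia.
      by split=> //; move: e_itv; rewrite gg; lia.
  by exists g => //; rewrite finset.inE -p; lia.
rewrite orbC (_ : (e \in _) = false).
  by rewrite orFb; lia.
apply/negbTE/finset.bigcupP => -[g _]; rewrite finset.inE -p mulnS; lia.
Qed.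

Definition at_index y e : R := y (decode e).1 (decode e).2.

(* Modulo the span of the indicators of the blocks, [block_vector y] is [y] with
   its block [i] scaled by the size of that block. *)
Definition block_vector y : V := \row_e
  \sum_(e' | index_block e' == index_block e) (at_index y e - at_index y e').

Definition ray k : V := rvec R (tube_set k).

Lemma indicatorE (J : {set 'I_n}) e : indicator R J 0 e = (e \in J)%:R.
Proof.
rewrite /indicator summxE; have [eJ|eJ] := boolP (e \in J).
  rewrite (bigD1 e) //= mxE !eqxx big1 ?addr0 // => j /andP[_ je].
  by rewrite mxE eqxx eq_sym (negbTE je).
rewrite big1 // => j jJ; rewrite mxE eqxx (_ : (e == j) = false) //.
by apply/negbTE; apply: contraNneq eJ => ->.
Qed.

(** For [e] in [J] the nonzero terms come from the part of the block outside [J], otherwise from the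
    part inside, with sign -1. This is the shape of [block_vector]. *)
Lemma rvecE (J : {set 'I_n}) e : rvec R J 0 e =
  \sum_(e' | index_block e' == index_block e) ((e \in J)%:R - (e' \in J)%:R).
Proof.
rewrite /rvec summxE (bigD1 (Ordinal (index_block_lt e))) //= [X in _ + X]big1
  => [|i ine]; last first.
  rewrite !mxE !indicatorE !finset.inE mem_block.
  rewrite (_ : (index_block e == i) = false) ?andbF ?mulr0 ?subr0 //.
  by apply: contraNF ine => /eqP ei; apply/eqP/val_inj.
rewrite addr0 !mxE !indicatorE !finset.inE mem_block eqxx andbT /=.
have [eJ|eJ] := boolP (e \in J); rewrite /= ?mulr1 ?mulr0 ?subr0 ?sub0r.
  rewrite -sum1_card natr_sum big_mkcond [RHS]big_mkcond;
    apply: eq_bigr => e' _.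
  by rewrite finset.inE mem_block; case: (e' \in J); case: eqP;
    rewrite ?subrr ?subr0.
rewrite -sum1_card natr_sum -sumrN big_mkcond [RHS]big_mkcond;
  apply: eq_bigr => e' _.
by rewrite finset.inE mem_block; case: (e' \in J); case: eqP;
  rewrite ?sub0r ?oppr0.
Qed.

Lemma ray_block_vector k : tube_in_range k ->
  ray k = block_vector (fun o j => (in_tube k o j)%:R).
Proof.
move=> kr; apply/rowP => e; rewrite rvecE mxE; apply: eq_bigr => e' _.
by rewrite /at_index !mem_tube_set.
Qed.

Lemma block_vectorD y z c :
  block_vector (fun o j => c * y o j + z o j) =
  c *: block_vector y + block_vector z.
Proof.
apply/rowP => e; rewrite !mxE mulr_sumr -big_split; apply: eq_bigr => e' _ /=.
by rewrite /at_index; ring.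
Qed.

Lemma block_vector_ext y z : (forall o j, y o j = z o j) ->
  block_vector y = block_vector z.
Proof.
by move=> yz; apply/rowP => e; rewrite !mxE; apply: eq_bigr => e' _;
  rewrite /at_index !yz.
Qed.

Lemma block_vector0 y : (forall o j, y o j = 0) -> block_vector y = 0.
Proof.
by move=> y0; apply/rowP => e; rewrite !mxE big1 // => e' _;
  rewrite /at_index !y0 subrr.
Qed.

Lemma poscomb_poscone ks y : all tube_in_range ks -> poscomb ks y ->
  poscone [seq ray k | k <- ks] (block_vector y).
Proof.
elim: ks y => [|k ks IH] y /=; first by move=> _; apply: block_vector0.
case/andP=> kr ksr [c [z [c0 kz yE]]]; exists c, (block_vector z).
split=> //; first exact: IH.
by rewrite ray_block_vector // -block_vectorD; apply: block_vector_ext.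
Qed.

Lemma poscone_poscomb ks x : all tube_in_range ks ->
  poscone [seq ray k | k <- ks] x -> exists2 y,
    poscomb ks y & x = block_vector y.
Proof.
elim: ks x => [|k ks IH] x /=.
  by move=> _ ->; exists (fun _ _ => 0) => //; rewrite block_vector0.
case/andP=> kr ksr [c [z [c0 /(IH _ ksr)[y ky ->] ->]]].
exists (fun o j => c * (in_tube k o j)%:R + y o j); first by exists c, y.
by rewrite ray_block_vector // -block_vectorD.
Qed.

Definition block_size e : R := #|[pred e' | index_block e' == index_block
  e]|%:R.

(** The sums over the block cancel, so the vector determines [y] up to a constant on each block. *)
Lemma block_vector_diff y e e0 : index_block e0 = index_block e ->
  block_vector y 0 e - block_vector y 0 e0 =
  block_size e * (at_index y e - at_index y e0).
Proof.
move=> ee0; rewrite !mxE ee0 -sumrB (eq_bigr (fun=> at_index y e - at_index y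
  e0)).
  by rewrite sumr_const mulr_natl.
by move=> e' _; ring.
Qed.

Lemma block_size_gt0 e : 0 < block_size e.
Proof. by rewrite ltr0n; apply/card_gt0P; exists e; rewrite inE. Qed.

Lemma HspaceP (x : V) : Hspace R l b u x <->
  forall e, \sum_(e' | index_block e' == index_block e) x 0 e' = 0.
Proof.
have dotE i : dot (indicator R (block l b u i)) x = \sum_(e' | index_block e'
  == i) x 0 e'.
  rewrite /dot [RHS]big_mkcond; apply: eq_bigr => e' _.
  by rewrite indicatorE mem_block; case: ifP; rewrite ?mul1r ?mul0r.
split=> [xH e|xH i]; first by rewrite -dotE;
  apply: (xH (Ordinal (index_block_lt e))).
(* A block may be empty: [I_0] is when [l = 1] and [b = 0]. *)
rewrite dotE; have [e /eqP<-|no] := pickP (fun e => index_block e == i);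
  first exact: xH.
by rewrite big_pred0.
Qed.

Lemma block_vector_Hspace y : Hspace R l b u (block_vector y).
Proof.
apply/HspaceP => e; under eq_bigr => e' /eqP ee'.
  rewrite mxE ee' sumrB; over.
rewrite sumrB; apply/eqP; rewrite subr_eq0; apply/eqP.
exact: exchange_big.
Qed.

End Rays.

(** * The cones of the trees *)

Section Triangularity.
Variable G : finType.
Implicit Types (T : ptree G) (F : seq (ptree G)).
Implicit Types (k : nat * nat * {set G}) (ks : seq (nat * nat * {set G})).

Fixpoint triangular ks : Prop :=
  if ks is k :: ks' then
    (exists o j, in_tube k o j /\ forall k', k' \in ks' -> ~~ in_tube k' o j)
    /\ triangular ks'
  else True.

(** In preorder, a node has a coordinate avoided by its proper subtrees, and later siblings live
    elsewhere. [ks] stands for whatever follows the forest in the list. *)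
Lemma triangular_ftubes_cat s F ks : all (@pebble_tree G) F -> triangular ks ->
  (forall k o j, k \in ks -> in_tube (s, fleaves F, [set: G]%SET) o j ->
    ~~ in_tube k o j) ->
  triangular (ftubes s F ++ ks).
Proof.
elim/forest_ind: F s ks => [//|F IH|p ch F IHch IHF] s ks /andP[okN okF] tks av.
  rewrite ftubes_leaf; apply: IH => // k o j kks r; apply: (av k o j kks).
  by move: r; rewrite /fleaves /=; case: o => [g|] /=; rewrite ?inE; lia.
have okch : all (@pebble_tree G) ch by move: okN;
  rewrite pebble_treeE => /and3P[].
rewrite ftubes_node cat_cons -catA.
have avF k o j : k \in ftubes (s + fleaves ch)%N F ++ ks ->
    in_tube (s, fleaves ch, [set: G]%SET) o j -> ~~ in_tube k o j.
  rewrite mem_cat => /orP[kF|kks] r.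
    apply/negP => /(ftubes_range kF); move: r.
    by case: o => [g|] /=; rewrite ?inE; lia.
  apply: (av k o j kks); move: r; rewrite /fleaves /=.
  by case: o => [g|] /=; rewrite ?inE; lia.
split.
  have [o [j [oj avch]]] := node_avoids_ftubes s okN; exists o, j; split=> // k.
  rewrite mem_cat => /orP[/avch //|/avF]; apply.
  by move: oj; case: (o) => [g|] /=; rewrite ?inE -/(fleaves ch); lia.
apply: IHch => //; apply: IHF => // k o j kks r; apply: (av k o j kks).
by move: r; rewrite /fleaves /=; case: o => [g|] /=;
  rewrite ?inE -!/(fleaves _); lia.
Qed.

Lemma triangular_ftubes s F : all (@pebble_tree G) F -> triangular (ftubes s F).
Proof. by move=> okF; have := @triangular_ftubes_cat s F [::] okF I;
  rewrite cats0; apply. Qed.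

Lemma ftubes_bounds s F k : all (@pebble_tree G) F -> k \in ftubes s F ->
  [&& s <= k.1.1, 0 < k.1.2 & k.1.1 + k.1.2 <= s + fleaves F]%N.
Proof.
elim/forest_ind: F s => [//|F IH|p ch F IHch IHF] s /andP[okN okF].
  by rewrite ftubes_leaf => /(IH _ okF); rewrite /fleaves /=; lia.
have okch : all (@pebble_tree G) ch by move: okN;
  rewrite pebble_treeE => /and3P[].
have := leaves_gt0 okN.
rewrite ftubes_node inE mem_cat => N0 /or3P[/eqP->|/(IHch _ okch)|/(IHF _ okF)];
  by move: N0; rewrite /fleaves /=; lia.
Qed.

End Triangularity.

(** * Independence of the rays and uniqueness of the tree of a vector *)

Section TreeCones.
Variables (R : realType) (l b u : nat).
Hypothesis l_gt0 : (0 < l)%N.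
Local Notation G := 'I_(b + u).
Local Notation n := (ambient_dim l b u).
Local Notation V := 'rV[R]_n.
Local Notation ray := (@ray R l b u).
Local Notation valid := (@valid l b u).
Implicit Types (T : ptree G) (F : seq (ptree G)) (g : G) (o : option G) (e :
  'I_n).
Implicit Types (k : nat * nat * {set G}) (ks : seq (nat * nat * {set G})).
Implicit Types (y : option G -> nat -> R).

Definition tubes T := ftubes 1 (children T).
Definition rays T : seq V := [seq ray k | k <- tubes T].

Definition bounded_colors : {set G} := [set g : G | (g < b)%N]%SET.

Lemma pebble_trees_balanced T :
  pebble_trees l b u T -> balanced_colors T = bounded_colors.
Proof. by case=> _ _ D; apply/setP => g; rewrite !finset.inE D; case: ifP. Qed.

Lemma pebble_trees_root T :
  pebble_trees l b u T -> tube (1%N, T) = (1%N, l, bounded_colors).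
Proof. by move=> PT; rewrite /tube /= pebble_trees_balanced //;
  case: PT => _ -> _. Qed.

Lemma pebble_trees_children T :
  pebble_trees l b u T -> all (@pebble_tree G) (children T).
Proof. by case; rewrite pebble_treeE => /and3P[]. Qed.

Lemma tubes_in_range T : pebble_trees l b u T -> all (@tube_in_range l b u)
  (tubes T).
Proof.
move=> PT; apply/allP => k kT.
have := ftubes_bounds (pebble_trees_children PT) kT; rewrite /tube_in_range.
case: PT => _ <- _; case: T kT => [//|p ch] _ /=.
by rewrite -/(fleaves ch); lia.
Qed.

Lemma tubes_range T k o j : pebble_trees l b u T -> k \in tubes T ->
  in_tube k o j -> valid o j.
Proof.
move=> [_ L _] kT /(ftubes_range kT); rewrite /valid -L.
by case: T kT {L} => [//|p ch] _; rewrite /= -/(fleaves ch).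
Qed.

Lemma in_root_tube o j :
  in_tube (1%N, l, bounded_colors) o j = valid o j && (color_block o == 0%N).
Proof.
rewrite /valid; case: o => [g|] /=; rewrite ?finset.inE ?andbT //.
by rewrite andTb andbC subn_eq0.
Qed.

(** The tube of the whole tree is exactly [I_0], so its ray is zero; so are the rays of leaves,
    whose tubes are empty. *)
Lemma tree_coneE T : pebble_trees l b u T -> @tree_cone R l b u T = cone (rays
  T).
Proof.
move=> PT; rewrite /tree_cone subtreesE.
have ray_root : rvec R (lambda l (1%N, T)) = 0.
  have -> : rvec R (lambda l (1%N, T)) = ray (tube (1%N, T)) by [].
  rewrite pebble_trees_root // ray_block_vector //; last first.
    by rewrite /tube_in_range /= l_gt0 add1n leqnn.
  apply/rowP => e; rewrite !mxE big1 // => e' /eqP ee'.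
  rewrite /at_index !in_root_tube -!/(index_block _) ee'.
  by rewrite (proj1 (decodeP l_gt0 e)) (proj1 (decodeP l_gt0 e')) subrr.
have -> : cone (rays T) = cone [seq rvec R (lambda l sS) | sS <- forest 1
  (children T)].
  rewrite (@cone_filter_zero _ _ _ (fun sS => rvec R (lambda l sS)) (fun sS =>
    is_node sS.2)).
    by rewrite /rays /tubes /ftubes -map_comp; congr cone; apply: eq_map => -[].
  case=> s [|//] _; apply/rowP => e; rewrite rvecE // !mxE big1 // => e' _.
  suff L0 e1 : (e1 \in lambda l (s,
    Leaf : ptree G)) = false by rewrite !L0 subrr.
  rewrite /= /boxtimes /otimes finset.in_setU finset.inE.
  rewrite (_ : (s <= _ <= _)%N = false); last by lia.
  rewrite big_pred0 ?finset.inE // => g.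
  by rewrite finset.inE.
apply/funext => x; apply/propext; split=> [/cone_cons[c [z [_ kz ->]]]|kx].
  by rewrite ray_root scaler0 add0r.
by apply/cone_cons; exists 0, x; rewrite ray_root scale0r add0r.
Qed.

(* This pins down the multiples of the indicators of the blocks which are
   neglected in [block_vector]. *)
Lemma block_avoids_tubes T e : pebble_trees l b u T ->
  exists2 e0 : 'I_n, index_block e0 = index_block e &
    forall k, k \in tubes T -> ~~ in_tube k (decode e0).1 (decode e0).2.
Proof.
move=> PT; have [v _] := decodeP l_gt0 e.
suff [o [j [vj oE av]]] : exists o j, [/\ valid o j,
    color_block o = index_block e &
    forall k, k \in tubes T -> ~~ in_tube k o j].
  have [e0 e0E] := decode_surj l_gt0 vj; exists e0;
    first by rewrite /index_block e0E.
  by rewrite e0E.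
(* Block 0 is the tube of the root, which has a coordinate avoided below; any other block is a color
   for which the tree is unbalanced. *)
have [e0|e0] := eqVneq (index_block e) 0%N.
  case: T PT => [|p ch] PT.
    by exists (decode e).1, (decode e).2; split.
  have [okT _ _] := PT; have [o [j [oj av]]] := node_avoids_ftubes 1 okT.
  exists o, j; move: oj; rewrite pebble_trees_root // in_root_tube => /andP[->
    /eqP ->].
  by rewrite e0.
move: e0; rewrite /index_block; case: (decode e).1 => [g|//] /= g0.
have [okT L DT] := PT.
have gT : Delta g T != 0 by rewrite DT ifF //; lia.
have ub : (0 < unbalanced g [:: T])%N by rewrite /unbalanced /= gT.
have [|j jr av] := @unbalanced_avoids_ftubes _ 1 [:: T] g _ ub;
  first by rewrite /= okT.
exists (Some g), j; split=> //.
  by move: jr; rewrite /valid /= finset.inE /fleaves /= L addn0.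
move=> k kT; apply: av; case: T kT {PT okT L DT gT ub jr} => [//|p ch] kT.
by rewrite ftubes1 // inE kT orbT.
Qed.

(** Take [e] in the first tube and in no later one, and [e0] in the same block but in no tube. The
    difference of these two coordinates vanishes on the later rays and not on the first. *)
Lemma free_rays T : pebble_trees l b u T -> free (rays T).
Proof.
move=> PT.
have tr : triangular (tubes T) by apply/triangular_ftubes/pebble_trees_children.
have valid_tubes k o j : k \in tubes T -> in_tube k o j -> valid o j.
  exact: tubes_range.
have av e := block_avoids_tubes e PT.
have rg := tubes_in_range PT.
rewrite /rays; elim: (tubes T) tr valid_tubes av rg => [|k ks IH] /=.
  by rewrite nil_free.
move=> [[o [j [oj ojks]]] tr] vt av /andP[kr ksr].
rewrite free_cons IH // ?andbT; last 2 first.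
- by move=> k' o' j' k'ks; apply: (vt k'); rewrite inE k'ks orbT.
- move=> e; have [e0 e0E H] := av e; exists e0 => // k' k'ks; apply: H.
  by rewrite inE k'ks orbT.
have vj : valid o j by apply: vt oj; apply: mem_head.
have [e eE] := decode_surj l_gt0 vj; have [e0 e0E e0av] := av e.
have diff k' : k' \in k :: ks -> ray k' 0 e - ray k' 0 e0 =
    block_size R e * (in_tube k' o j)%:R.
  move=> k'ks; rewrite ray_block_vector //;
    last by apply: (allP (_ : all _ (k :: ks))); rewrite //= kr.
  by rewrite block_vector_diff // /at_index (negbTE (e0av k' k'ks)) eE subr0.
apply/negP => /(@coord_span _ _ _ (in_tuple _)) kE.
have := diff k (mem_head _ _); rewrite oj mulr1 kE !summxE -sumrB big1.
  by move/eqP; rewrite lt_eqF // block_size_gt0.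
move=> i _; rewrite !mxE -mulrBr.
have iks : (i < size ks)%N by rewrite -(size_map ray ks).
set k0 : nat * nat * {set G} := (0%N, 0%N, finset.set0).
have -> : (in_tuple [seq ray k' | k' <- ks])`_i = ray (nth k0 ks i) by rewrite
  (nth_map k0).
rewrite diff; last by rewrite inE mem_nth ?orbT.
by rewrite (negbTE (ojks _ _)) ?mem_nth // !mulr0.
Qed.

Lemma poscone_tree T x : pebble_trees l b u T -> poscone (rays T) x ->
  exists y, [/\ poscomb (tubes T) y, x = @block_vector R l b u y,
    (forall e, 0 <= at_index y e),
    (forall o j, ~~ valid o j -> y o j = 0) &
    (forall e, exists2 e0 : 'I_n,
      index_block e0 = index_block e & at_index y e0 = 0)].
Proof.
move=> PT /(poscone_poscomb l_gt0 (tubes_in_range PT))[y ky ->].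
exists y; split=> //.
- by move=> e; apply: poscomb_ge0 ky.
- move=> o j nv; apply: (poscomb_eq0 ky) => k kT; apply: contra nv.
  exact: tubes_range kT.
- move=> e; have [e0 e0E av] := block_avoids_tubes e PT; exists e0 => //.
  exact: (poscomb_eq0 ky).
Qed.

(** The functions [y] and [y'] agree up to a constant on each block, where both have minimum 0, so
    they are equal. *)
Lemma poscone_rays_inj T T' x : pebble_trees l b u T -> pebble_trees l b u T' ->
  poscone (rays T) x -> poscone (rays T') x -> T = T'.
Proof.
move=> PT PT' /(poscone_tree PT)[y [ky xy y0 yv yz]].
move=> /(poscone_tree PT')[y' [ky' xy' y0' yv' yz']].
have yy' e : at_index y e = at_index y' e.
  have D e1 : index_block e1 = index_block e ->
      at_index y e - at_index y e1 = at_index y' e - at_index y' e1.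
    move=> e1E; apply: (mulfI (lt0r_neq0 (block_size_gt0 R e))).
    by rewrite -!block_vector_diff // -xy -xy'.
  have [e0 e0E e00] := yz e; have [e1 e1E e10] := yz' e.
  have := D e0 e0E; have := D e1 e1E; rewrite e00 e10.
  by have := y0' e0; have := y0 e1; lra.
have yyE o j : y o j = y' o j.
  have [v|nv] := boolP (valid o j); last by rewrite yv // yv'.
  by have [e eE] := decode_surj l_gt0 v; have := yy' e; rewrite /at_index eE.
(* Adding the tube of the root with coefficient 1 makes uniqueness apply to the one-tree forests,
   root pebbles included. *)
pose w o j := (in_tube (1%N, l, bounded_colors) o j)%:R + y o j.
have kw T1 z : pebble_trees l b u T1 -> poscomb (tubes T1) z ->
    (forall o j, y o j = z o j) -> poscomb (ftubes 1 [:: T1]) w.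
  move=> PT1 kz yz1; case: T1 PT1 kz => [|p ch] PT1 kz.
    move=> o j; rewrite /w yz1 kz addr0 -(pebble_trees_root PT1).
    suff -> : in_tube (tube (1%N, Leaf : ptree G)) o j = false by [].
    by case: o => [g|] /=; rewrite ?finset.inE //; lia.
  rewrite ftubes1 //; exists 1, z; split=> // o j.
  by rewrite mul1r /w yz1 (pebble_trees_root PT1).
have [okT L _] := PT; have [okT' L' _] := PT'.
suff [] : [:: T] = [:: T'] by [].
apply: (poscomb_forest_inj (s := 1) (y := w)); rewrite ?all_seq1 //.
- by rewrite /fleaves /= L L'.
- exact: kw ky _.
- exact: kw ky' _.
Qed.

End TreeCones.

(** * Completeness, inclusions and intersections of the cones *)

Section Fan.
Variables (R : realType) (l b u : nat).
Hypothesis l_gt0 : (0 < l)%N.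
Local Notation G := 'I_(b + u).
Local Notation n := (ambient_dim l b u).
Local Notation V := 'rV[R]_n.
Local Notation rays := (@rays R l b u).
Local Notation valid := (@valid l b u).
Local Notation bounded_colors := (bounded_colors b u).
Local Notation tree_cone := (@tree_cone R l b u).
Implicit Types (T : ptree G) (F : seq (ptree G)) (g : G) (o : option G) (e :
  'I_n).

Lemma pebble_treesI T : pebble_tree T -> leaves T = l ->
  balanced_colors T = bounded_colors -> pebble_trees l b u T.
Proof.
move=> okT L B; split=> // g.
move: okT; rewrite pebble_treeE => /and3P[_ /forallP /(_ g) D01 _].
have : (g \in balanced_colors T) = (g \in bounded_colors) by rewrite B.
by rewrite !finset.inE; case: ifP; move: D01; case: eqP => // _ /eqP ->.
Qed.

(** Shifting each block of [x] to minimum 0 and dividing by its size gives a nonnegative [y], whose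
    forest becomes the children of the root. *)
Lemma poscone_exists (x : V) : Hspace R l b u x ->
  exists2 T, pebble_trees l b u T & poscone (rays T) x.
Proof.
move=> /(HspaceP l_gt0) xH.
(* Here every block has at most one coordinate, so [x] is zero. Block 0 is empty and offers no zero
   to [node_of_forest]. *)
have [/andP[/eqP l1 /eqP b0]|nondeg] := boolP ((l == 1) && (b == 0))%N.
  exists Leaf.
    apply: pebble_treesI; [exact: pebble_tree_leaf|by rewrite l1|].
    by apply/setP => g; rewrite !finset.inE /Delta /=; lia.
  apply/rowP => e; rewrite mxE -[RHS](xH e) (big_pred1 e) // => e' /=.
  apply/eqP/eqP => [ee'|->//]; apply: val_inj; apply: succn_inj.
  have [v p] := decodeP l_gt0 e; have [v' p'] := decodeP l_gt0 e'.
  rewrite -[LHS]p' -[RHS]p; move: ee' v v'; rewrite /index_block /valid.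
  by case: (decode e) (decode e') => [[g|] j] [[g'|] j'] /=;
    rewrite ?finset.inE; lia.
pose P e e' := index_block e' == index_block e.
pose m e := [arg min_(e' < e | P e e') x 0 e']%O.
have mP e : P e (m e) /\ forall e', P e e' -> x 0 (m e) <= x 0 e'.
  by rewrite /m; case: arg_minP => [|e1 Pe1 min1]; [rewrite /P|split].
pose y o j := if [pick e | decode e == (o, j)] is Some e
  then (x 0 e - x 0 (m e)) / block_size R e else 0.
have decode_inj : injective (@decode l b u).
  move=> e e' ee'; apply: val_inj; apply: succn_inj.
  by rewrite -[LHS](proj2 (decodeP l_gt0 e)) -[RHS](proj2 (decodeP l_gt0 e'))
    ee'.
have yE e : at_index y e = (x 0 e - x 0 (m e)) / block_size R e.
  rewrite /at_index /y; case: pickP => [e' /eqP|/(_ e)].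
    by rewrite -surjective_pairing => /decode_inj ->.
  by rewrite -surjective_pairing eqxx.
have y_ge0 o j : 0 <= y o j.
  rewrite /y; case: pickP => // e _;
    rewrite divr_ge0 ?(ltW (block_size_gt0 _ _)) //.
  by rewrite subr_ge0; apply: (mP e).2; rewrite /P.
have yv o j : ~~ valid o j -> y o j = 0.
  move=> nv; rewrite /y; case: pickP => // e /eqP eE; case/negP: nv.
  by have [] := decodeP l_gt0 e; rewrite eE.
have [F [okF LF ky]] := poscomb_exists y_ge0 yv.
have F0 : (0 < size F)%N by rewrite lt0n; move: l_gt0; rewrite -LF; case: (F).
have block_same e : block_size R (m e) = block_size R e.
  by rewrite /block_size (eqP (mP e).1).
have yxE e e' : P e e' -> at_index y e - at_index y e' = (x 0 e - x 0 e') /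
  block_size R e.
  move=> /eqP ee'; rewrite !yE.
  have me : x 0 (m e) = x 0 (m e').
    apply/eqP; rewrite eq_le (mP e).2 ?(mP e').2 //.
      by rewrite /P ee' (eqP (mP e).1).
    by rewrite /P -ee' (eqP (mP e').1).
  have -> : block_size R e' = block_size R e by rewrite /block_size ee'.
  by rewrite me -mulrBl; congr (_ / _); ring.
have y_min e : exists e0, P e e0 /\ at_index y e0 = 0.
  exists (m e); have Pm := (mP e).1; split=> //.
  have Pmm : P e (m (m e)) by rewrite /P (eqP (mP (m e)).1) (eqP Pm).
  rewrite yE (_ : x 0 (m e) - x 0 (m (m e)) = 0) ?mul0r //.
  apply/eqP; rewrite subr_eq0 eq_le (mP e).2 //= (mP (m e)).2 //.
  by rewrite /P.
(* The zero of [y] in each block serves the colors beyond [b] and, for block 0, the tube of the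
   root. *)
have [||p [okN BN]] := @node_of_forest R _ 1 F y bounded_colors okF F0 ky.
- move=> g gb; have v1 : valid (Some g) 1 by rewrite /valid /= finset.inE; lia.
  have [e eE] := decode_surj l_gt0 v1; have [e0 [/eqP Pe0 ye0]] := y_min e.
  have [v0 _] := decodeP l_gt0 e0; move: Pe0 ye0 v0 gb.
  rewrite /index_block /at_index eE finset.inE /valid.
  case: (decode e0) => [[g0|] j0] /=; rewrite ?finset.inE; last by lia.
  move=> gg yj jr gb; exists j0; first by rewrite LF; lia.
  by have <- : g0 = g by apply: val_inj => /=; lia.
(* Block 0 contains a gap if [l > 1] and the first color if [b > 0]. *)
- have [e e0] : exists e, index_block e = 0%N.
    have [l2|l1] := ltnP 1 l.
      have v1 : valid None 1 by rewrite /valid /=; lia.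
      by have [e eE] := decode_surj l_gt0 v1; exists e; rewrite /index_block eE.
    have b0 : (0 < b)%N by move: nondeg; lia.
    have bu0 : (0 < b + u)%N by lia.
    have v1 : valid (Some (Ordinal bu0)) 1 by rewrite /valid /= finset.inE; lia.
    by have [e eE] := decode_surj l_gt0 v1; exists e;
      rewrite /index_block eE /=; lia.
  have [e1 [/eqP Pe1 ye1]] := y_min e.
  exists (decode e1).1, (decode e1).2; split=> //.
  rewrite LF in_root_tube; have [-> _] := decodeP l_gt0 e1.
  by rewrite -/(index_block e1) Pe1 e0.
exists (Node p F).
  by apply: pebble_treesI => //; rewrite -LF.
suff -> : x = @block_vector R l b u y.
  apply: (poscomb_poscone l_gt0) ky;
    apply: (@tubes_in_range _ _ _ l_gt0 (Node p F)).
  by apply: pebble_treesI => //; rewrite -LF.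
(* The block sums of [x] vanish, so only the size of the block times [x 0 e] remains, which the
   division cancels. *)
apply/rowP => e; rewrite mxE (eq_bigr (fun e' => (x 0 e - x 0 e') / block_size
  R e)).
  rewrite -mulr_suml sumrB sumr_const xH subr0 -[x 0 e *+ _]mulr_natr.
  by rewrite mulfK ?lt0r_neq0 ?block_size_gt0.
by move=> e' Pe'; apply: yxE.
Qed.

Lemma cone_rays_Hspace T (x : V) : pebble_trees l b u T ->
  cone (rays T) x -> Hspace R l b u x.
Proof.
move=> PT /cone_poscone[ks ss kx].
have [|y _ ->] := poscone_poscomb l_gt0 _ kx; last exact: block_vector_Hspace.
by apply/allP => k /(mem_subseq ss); apply/allP/tubes_in_range.
Qed.

Lemma contraction_pebble_trees T' T :
  contraction_le T' T -> pebble_trees l b u T -> pebble_trees l b u T'.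
Proof.
move=> T'T [okT L D]; have [okT' L' D'] := contraction_le_pebble_tree T'T okT.
by split; rewrite ?L' // => g; rewrite D' D.
Qed.

Lemma cone_contraction T (x : V) : pebble_trees l b u T -> cone (rays T) x ->
  exists T', [/\ contraction_le T' T,
    pebble_trees l b u T' & poscone (rays T') x].
Proof.
move=> PT /cone_poscone[ks /subseq_contraction[T' T'T <-] kx].
by exists T'; split=> //; apply: contraction_pebble_trees PT.
Qed.

Lemma contraction_le_rays T' T :
  contraction_le T' T -> {subset rays T' <= rays T}.
Proof. by move=> /(contraction_le_subseq 1)/(map_subseq (@ray R l b
  u))/mem_subseq. Qed.

(** The contraction of [T'] with [x] in its relative interior is [T] by uniqueness. *)
Lemma poscone_contraction_le T T' (x : V) :
  pebble_trees l b u T -> pebble_trees l b u T' ->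
  poscone (rays T) x -> cone (rays T') x -> contraction_le T T'.
Proof.
move=> PT PT' kx /(cone_contraction PT')[T1 [T1T' PT1 kx1]].
by rewrite (poscone_rays_inj l_gt0 PT PT1 kx kx1).
Qed.

Lemma cone_subset_contraction_le T T' :
  pebble_trees l b u T -> pebble_trees l b u T' ->
  (cone (rays T) `<=` cone (rays T'))%classic <-> contraction_le T T'.
Proof.
move=> PT PT'; split=> [TT'|/contraction_le_rays]; last exact: cone_sub.
have kT := poscone_sum (rays T).
exact: poscone_contraction_le kT (TT' _ (poscone_cone kT)).
Qed.

(** Trees that contract to each other have the same tubes, each list being a subsequence of the
    other; uniqueness for the sum of the rays then identifies the trees. *)
Lemma cone_rays_inj T T' : pebble_trees l b u T -> pebble_trees l b u T' ->
  cone (rays T) = cone (rays T') -> T = T'.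
Proof.
move=> PT PT' TT'.
have T_T' : contraction_le T T' by apply/(cone_subset_contraction_le PT PT');
  rewrite TT'.
have T'_T : contraction_le T' T by apply/(cone_subset_contraction_le PT' PT);
  rewrite TT'.
have eT : tubes T = tubes T'.
  apply/eqP; rewrite -(geq_leqif (size_subseq_leqif (contraction_le_subseq 1
    T_T'))).
  exact: size_subseq (contraction_le_subseq 1 T'_T).
have kT := poscone_sum (rays T).
by apply: (poscone_rays_inj l_gt0 PT PT' kT); rewrite /rays -eT.
Qed.

Lemma cone_rays_meet T T' : pebble_trees l b u T -> pebble_trees l b u T' ->
  (cone (rays T) `&` cone (rays T'))%classic = cone [seq v <- rays T | v \in
    rays T'].
Proof.
move=> PT PT'; apply/seteqP; split=> x /=; last first.
  by move=> kx; split; apply: cone_sub kx => v; rewrite mem_filter => /andP[].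
case=> /(cone_contraction PT)[T1 [T1T PT1 kx1]] kx'.
have T1T' := poscone_contraction_le PT1 PT' kx1 kx'.
apply: cone_sub (poscone_cone kx1) => v vT1.
by rewrite mem_filter (contraction_le_rays T1T vT1) (contraction_le_rays T1T'
  vT1).
Qed.

Lemma pebble_tree_fanP (C : set V) : pebble_tree_fan R l b u C <->
  exists2 T, pebble_trees l b u T & C = cone (rays T).
Proof.
split=> [[T PT <-]|[T PT ->]]; exists T => //; first exact: tree_coneE.
exact: tree_coneE.
Qed.

End Fan.

Local Open Scope classical_set_scope.

Theorem theorem34 (R : realType) (l b u : nat) (hl : (1 <= l)%N) :
  [/\ fan (pebble_tree_fan R l b u),
      essential (pebble_tree_fan R l b u),
      complete_in (Hspace R l b u) (pebble_tree_fan R l b u),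
      simplicial (pebble_tree_fan R l b u)
    & poset_isomorphic
        (pebble_tree_fan R l b u) (fun C D => C `<=` D)
        (pebble_trees l b u) (@contraction_le 'I_(b + u))].
Proof.
split.
- split=> [C [T PT <-]|C D|C D].
  + by exists [seq rvec R (lambda l sS) | sS <- subtrees 1 T].
  + case/(pebble_tree_fanP hl) => T PT -> /face_of_cone[P ->].
    apply/(pebble_tree_fanP hl).
    (* A choice of rays is a choice of tubes, which a contraction realizes. *)
    have ss : subseq [seq k <- tubes T | P (ray R l k)] (tubes T) by apply:
      filter_subseq.
    have [T' T'T T'E] := subseq_contraction ss; exists T'.
      exact: contraction_pebble_trees PT.
    by rewrite {2}/rays /tubes T'E filter_map.
  + case/(pebble_tree_fanP hl) => T PT -> /(pebble_tree_fanP hl)[T' PT' ->].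
    split; last rewrite setIC; rewrite cone_rays_meet //;
      exact: free_cone_face (free_rays _ hl _).
- apply/seteqP; split=> [x Hx|_ -> C /(pebble_tree_fanP hl)[T _ ->]];
  last exact: cone0.
  (* Some tree exists by applying [poscone_exists] to 0; contracting away all its proper tubes
     leaves a tree with cone zero. *)
  have H0 : Hspace R l b u 0 by move=> i; rewrite dot0r.
  have [T1 PT1 _] := poscone_exists hl H0.
  have [T T1T ET] := subseq_contraction (sub0seq (tubes T1)).
  have PT := contraction_pebble_trees T1T PT1.
  have E : rays R l T = [::] by rewrite /rays /tubes ET.
  have := Hx (cone (rays R l T)); rewrite E => Hx0; apply/cone_nil; apply: Hx0.
  by apply/(pebble_tree_fanP hl); exists T; rewrite ?E.
- apply/seteqP; split=> [x [C /(pebble_tree_fanP hl)[T PT ->]]|x Hx].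
    exact: cone_rays_Hspace.
  have [T PT kx] := poscone_exists hl Hx; exists (cone (rays R l T)).
    by apply/(pebble_tree_fanP hl); exists T.
  exact: poscone_cone.
- move=> C /(pebble_tree_fanP hl)[T PT ->]; exists (rays R l T); split=> //.
  exact: free_rays.
(* The isomorphism sends a cone to its tree; sets outside the fan get the default [Leaf]. *)
have inv C : exists T, pebble_tree_fan R l b u C -> pebble_trees l b u T /\ C =
  cone (rays R l T).
  have [/(pebble_tree_fanP hl)[T PT CE]|nC] := pselect (pebble_tree_fan R l b u
    C).
    by exists T.
  by exists Leaf.
have [f fP] := choice inv; exists f; split; last first.
  move=> C D /fP[PT {1}->] /fP[PT' {1}->].
  exact: cone_subset_contraction_le.
split.
- by move=> C /fP[].
- move=> C D; rewrite !inE => /fP[_ {2}->] /fP[_ {2}->] ->; by [].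
- move=> T PT; exists (cone (rays R l T)).
    by apply/(pebble_tree_fanP hl); exists T.
  have [|PfT TE] := fP (cone (rays R l T)).
    by apply/(pebble_tree_fanP hl); exists T.
  exact: esym (cone_rays_inj hl PT PfT TE).
Qed.
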